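(* Let $B$ be a standard Brownian motion and, for $c>0$, let $B^c$ be obtained from $B$ by the construction $X\mapsto X^c$ described in the context. For $n=1,2,\dots$ set $\delta(n)=1/n$, $$Z^{\delta(n)}=2B^{1/n^2}+n\left(B^{1/(2n^2)}-B^{1/n^2}\right),\qquad \tilde B^{\delta(n)}=B^{1/n^2}.$$ Let $Z=2B$ and $\tilde B=B$. Then, with finite constants $K_T,L_T$ ($T\ge 0$) not depending on $n$, both pairs $(W,W^{\delta(n)})=(Z,Z^{\delta(n)})$ and $(W,W^{\delta(n)})=(\tilde B,\tilde B^{\delta(n)})$ satisfy, for every $n$: (1) $W^{\delta(n)}$ has locally finite total variation; (2) $W^{\delta(n)}$ has càdlàg paths; (3) for every $T\ge 0$ and $t\in[0,T]$, $|W_t-W_t^{\delta(n)}|\le K_T\delta(n)$; (4) for every $T\ge0$ and $t\in[0,T]$, $|\Delta W^{\delta(n)}_t|\le L_T|\Delta W_t|$; (5) $W^{\delta(n)}$ is adapted to the natural filtration of $B$ (made right-continuous and complete). Moreover the pathwise Lebesgue–Stieltjes integrals satisfy $$\int_0^1 Z^{\delta(n)}\,\mathrm d\tilde B^{\delta(n)}\to+\infty\quad\text{almost surely as } n\to\infty.$$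
   Context: $\Delta x_t=x_t-x_{t-}$ for $t>0$, $\Delta x_0=0$. Construction of $X^c$ from a càdlàg path $X$ and $c>0$. Let $T_u^{2c}X=\inf\{s\ge0:\sup_{t\in[0,s]}X_t-X_0>c\}$ and $T_d^{2c}X=\inf\{s\ge0:X_0-\inf_{t\in[0,s]}X_t>c\}$ ($\inf\emptyset=+\infty$). If $T_d^{2c}X\ge T_u^{2c}X$, put $T_{u,0}^{2c}=T_u^{2c}X$ and for $k=0,1,2,\dots$ $$T_{d,k}^{2c}=\inf\{s\ge T_{u,k}^{2c}:\sup_{t\in[T_{u,k}^{2c},s]}X_t-X_s>2c\}\ \text{ if } T_{u,k}^{2c}<+\infty,\quad T_{d,k}^{2c}=+\infty\text{ otherwise},$$ $$T_{u,k+1}^{2c}=\inf\{s\ge T_{d,k}^{2c}:X_s-\inf_{t\in[T_{d,k}^{2c},s]}X_t>2c\}\ \text{ if } T_{d,k}^{2c}<+\infty,\quad T_{u,k+1}^{2c}=+\infty\text{ otherwise},$$ and define $$X_s^c=\begin{cases}X_0 & s\in[0,T_{u,0}^{2c}),\\ \sup_{t\in[T_{u,k}^{2c},s]}X_t-c & s\in[T_{u,k}^{2c},T_{d,k}^{2c}),\ k\ge0,\\ \inf_{t\in[T_{d,k}^{2c},s]}X_t+c & s\in[T_{d,k}^{2c},T_{u,k+1}^{2c}),\ k\ge0.\end{cases}$$ If $T_d^{2c}X<T_u^{2c}X$, apply this construction to $-X$ and set $X^c=-\big((-X)^c\big)$. For a stochastic process the construction is applied pathwise. *)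

(* Defs.v *)
From HB Require Import structures.
From mathcomp Require Import all_boot all_order all_algebra.
From mathcomp Require Import all_classical all_reals all_analysis.

Set Implicit Arguments.
Unset Strict Implicit.
Unset Printing Implicit Defensive.

Import Order.TTheory GRing.Theory Num.Theory.
Import numFieldNormedType.Exports.

Local Open Scope classical_set_scope.
Local Open Scope ring_scope.

(** Time is the half-line [0, +oo[ of [R]: a path is a function [R -> R] and a
    process a function [R -> T -> R], of which only the values at times
    [0 <= t] are meaningful. *)

Section paths.
Context {R : realType}.
Implicit Types (X f : R -> R) (c : R).

Definition cadlag f : Prop :=
  (forall t, 0 <= t -> f x @[x --> t^'+] --> f t) /\
  (forall t, 0 < t -> cvg (f x @[x --> t^'-])).

Definition jump f (t : R) : R :=
  if 0 < t then f t - lim (f x @[x --> t^'-]) else 0.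

Definition locally_finite_variation f : Prop :=
  forall t, 0 <= t -> bounded_variation 0 t f.

(** [sup] and [inf] are the real-valued ones, which are genuine suprema and
    infima here because a càdlàg path is bounded on compact intervals. Hitting
    times are extended reals, [ereal_inf set0] being [+oo]. *)
Definition path_sup X (a b : R) : R := sup (X @` `[a, b]).
Definition path_inf X (a b : R) : R := inf (X @` `[a, b]).

Definition first_time (A : set R) : \bar R := ereal_inf (EFin @` A).

Definition start_up c X : \bar R :=
  first_time [set s | 0 <= s /\ path_sup X 0 s - X 0 > c].

Definition start_down c X : \bar R :=
  first_time [set s | 0 <= s /\ X 0 - path_inf X 0 s > c].

Definition next_down c X (u : \bar R) : \bar R :=
  if u is r%:E then
    first_time [set s | r <= s /\ path_sup X r s - X s > 2 * c]
  else +oo%E.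

Definition next_up c X (u : \bar R) : \bar R :=
  if u is r%:E then
    first_time [set s | r <= s /\ X s - path_inf X r s > 2 * c]
  else +oo%E.

Fixpoint up_time c X (k : nat) : \bar R :=
  if k is j.+1 then next_up c X (next_down c X (up_time c X j))
  else start_up c X.

Definition down_time c X (k : nat) : \bar R := next_down c X (up_time c X k).

Definition reg_piece c X (s y : R) : Prop :=
  [\/ (s%:E < up_time c X 0)%E /\ y = X 0,
      exists k, (up_time c X k <= s%:E < down_time c X k)%E /\
        y = path_sup X (fine (up_time c X k)) s - c
    | exists k, (down_time c X k <= s%:E < up_time c X k.+1)%E /\
        y = path_inf X (fine (down_time c X k)) s + c].

(** The time intervals in [reg_piece] are pairwise disjoint, and they cover
    [0, +oo[ when [X] is càdlàg and [0 < c]; so the value picked by [xget] is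
    the one prescribed by the case distinction and the default is not used. *)
Definition reg_up c X (s : R) : R := xget (X 0) [set y | reg_piece c X s y].

(** [reg c X] is the path usually written [X^c]. *)
Definition reg c X : R -> R :=
  if (start_up c X <= start_down c X)%E then reg_up c X
  else \- (reg_up c (\- X)).

(** [lebesgue_stieltjes_integral f g a b I]: the Lebesgue-Stieltjes integral of
    [f] with respect to [dg] over ]a, b] exists and equals [I]. The measure [dg]
    is the difference of the measures of two nondecreasing right-continuous
    functions whose difference is [g] on [a, b]; [I] does not depend on the
    decomposition. *)
Definition lebesgue_stieltjes_integral (f g : R -> R) (a b I : R) : Prop :=
  exists u v : cumulative R R,
    [/\ {in `[a, b], forall t, g t = u t - v t},
        (lebesgue_stieltjes_measure u).-integrable `]a, b] (EFin \o f),
        (lebesgue_stieltjes_measure v).-integrable `]a, b] (EFin \o f) &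
        I = \int[lebesgue_stieltjes_measure u]_(t in `]a, b]) f t
          - \int[lebesgue_stieltjes_measure v]_(t in `]a, b]) f t].

End paths.

Section processes.
Context {R : realType} {d : measure_display} {T : measurableType d}.
Variable P : probability T R.
Implicit Types (B W : R -> T -> R) (F : R -> set (set T)).

Definition reg_process c B : R -> T -> R := fun t w => reg c (B ^~ w) t.

Definition natural_filtration B : R -> set (set T) := fun t =>
  <<s [set E | exists2 s, 0 <= s <= t &
        exists2 A : set R, measurable A & E = B s @^-1` A] >>.

(** The usual augmentation: all subsets of [P]-null events are added, and the
    result is made right-continuous. *)
Definition augmentation F : R -> set (set T) := fun t =>
  \bigcap_(s in [set s | t < s]) <<s F s `|` [set N | P.-negligible N] >>.

Definition adapted F W : Prop :=
  forall t, 0 <= t -> forall A : set R, measurable A -> F t (W t @^-1` A).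

Definition standard_brownian_motion B : Prop :=
  [/\ forall t, 0 <= t -> measurable_fun setT (B t),
      {ae P, forall w, B 0 w = 0},
      forall w, {within `[0, +oo[, continuous (B ^~ w)},
      forall s t, 0 <= s < t -> forall A : set R, measurable A ->
        P ((fun w => B t w - B s w) @^-1` A)
          = normal_prob 0 (Num.sqrt (t - s)) A &
      forall s t, 0 <= s < t ->
        forall E, natural_filtration B s E -> forall A : set R, measurable A ->
        let D := (fun w => B t w - B s w) @^-1` A in
        P (E `&` D) = (P E * P D)%E].

(** The sequence [Wn], [n >= 1], approximates [W] with speed [delta] and
    constants [K], [L], and consists of càdlàg, [F]-adapted processes of locally
    finite variation. *)
Definition fv_approximation F (K L : R -> R) (delta : nat -> R)
    W (Wn : nat -> R -> T -> R) : Prop :=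
  forall n, (0 < n)%N ->
  [/\ forall w, locally_finite_variation (Wn n ^~ w),
      forall w, cadlag (Wn n ^~ w),
      forall w S t, 0 <= t <= S -> `|W t w - Wn n t w| <= K S * delta n,
      forall w S t, 0 <= t <= S ->
        `|jump (Wn n ^~ w) t| <= L S * `|jump (W ^~ w) t| &
      adapted F (Wn n)].

Definition delta (n : nat) : R := n%:R^-1.

Definition Btilde_approx B (n : nat) : R -> T -> R :=
  reg_process (n%:R ^+ 2)^-1 B.

Definition Z_approx B (n : nat) : R -> T -> R := fun t w =>
  2 * reg_process (n%:R ^+ 2)^-1 B t w
  + n%:R * (reg_process (2 * n%:R ^+ 2)^-1 B t w
            - reg_process (n%:R ^+ 2)^-1 B t w).

End processes.

(* Main.v *)
Require Import Defs.
From mathcomp Require Import all_boot all_order all_algebra.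
From mathcomp Require Import all_classical all_reals all_analysis.
From mathcomp Require Import measurable_realfun.
From HB Require Import structures.
From mathcomp Require Import ring lra.
Import Order.TTheory GRing.Theory Num.Theory.
Import numFieldNormedType.Exports.
Local Open Scope classical_set_scope.
Local Open Scope ring_scope.

(** The alternating first passage times that define [y = reg c X] amount to a
    single local rule, the play rule of hysteresis: on every interval [s, t] on
    which [X] oscillates by at most [2 * c], the value [y t] is [y s] clamped to
    the interval [sup X - c, inf X + c] ([play_reg]). Each phase of the
    construction obeys the rule, the rule passes to concatenated intervals, and
    only finitely many phases start before a given time, since a phase lasts
    until [X] has moved by [2 * c]. The proof uses only this rule.

    Regularity. By the rule [y] stays within [c] of [X], moves by no more than
    the oscillation of [X], hence is continuous and has no jump, and is monotone
    on short intervals, hence has locally finite variation. The rule applied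
    along a finite grid gives a function of finitely many past values of [X],
    and these functions converge to [y t] when the grid is refined: this gives
    adaptedness without any discussion of stopping times
    ([reg_process_past]).

    Divergence. Let [z = reg (c / 2) X]. When [y] increases, [y = X - c] while
    [z >= X - c / 2], so [z - y >= c / 2]; symmetrically [z - y <= - c / 2] when
    [y] decreases ([play_gap]). So the integral of [z - y] with respect to [dy]
    is at least [c / 2] times the total variation of [y], while twice the
    integral of [y] with respect to [dy] is [y 1 ^+ 2 - y 0 ^+ 2], at least
    [- X 0 ^+ 2]. For [c = 1 / n ^ 2], the integral in question is therefore at
    least [V / (2 * n)] up to a constant, [V] being the variation of [y] on
    [0, 1] ([play_integral_ge]).

    It remains to see that [V / n] tends to infinity almost surely. As [y] is
    within [c] of [X], [V] is at least the sum of [`|X t' - X t| - 2 * c] over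
    any set of steps [t, t'] of a grid. Take the grid with [m = 4 * n ^ 3] steps
    and call a step big when the increment exceeds half its standard deviation
    [m ^ (- 1 / 2)]. Each step is big with probability at least one half
    independently of the past, so the probability of at most [j] big steps among
    [k] is at most [2 ^ j * (3 / 4) ^ k] ([few_big_steps_le]). With [k = m] and
    [j = n ^ 3] this is [(81 / 128) ^ (n ^ 3)], a summable sequence; by
    Borel-Cantelli, eventually more than [n ^ 3] steps are big, and then [V / n]
    is at least of order [sqrt n]. *)

Set Implicit Arguments.
Unset Strict Implicit.
Unset Printing Implicit Defensive.

(** * Continuous paths on a half-line *)
Ltac real_lra := repeat match goal with
  | H : is_true (_ <= _)%E |- _ => clear H
  | H : is_true (_ < _)%E |- _ => clear H
  | H : @eq (\bar _) _ _ |- _ => clear H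
  end; lra.

Section continuity.
Context {R : realType}.
Implicit Types (X g : R -> R) (r s t a b c e K : R).

(** Continuity on [r, +oo[, in the form of uniform continuity on every [r, T]:
    the moduli serve to cut [r, T] into finitely many short intervals. *)
Definition unif_cont r g : Prop := forall T e, 0 < e ->
  exists2 d, 0 < d & forall s t, r <= s -> s <= t -> t <= T -> t - s < d ->
    `|g t - g s| < e.

Lemma unif_cont_path X : {within `[0, +oo[, continuous X} -> unif_cont 0 X.
Proof.
move=> cX T e e0.
have /compact_near_coveringP/near_covering_withinP cov := @segment_compact R 0 T.
pose P (d x : R) := forall s, 0 <= s -> `|s - x| < d -> `|X s - X x| < e.
have : \forall d \near 0^'+, `[0, T] `<=` P d.
  apply: cov => x; rewrite /= in_itv/= => /andP[x0 xT].
  have e20 : 0 < e / 2 by lra.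
  have Hx : \forall t \near x, 0 <= t -> `|X x - X t| < e / 2.
    move/subspace_continuousP: cX => /(_ x); rewrite /= in_itv/= x0 => /(_ isT).
    move=> /cvgrPdist_lt/(_ _ e20); rewrite near_withinE.
    by apply: filterS => t H t0; apply: H; rewrite /= in_itv/= t0.
  case: Hx => h /= h0 Hx; near=> x' d => /=; rewrite in_itv/= => /andP[x'0 x'T] s s0 sx'.
  have x'h : `|x - x'| < h / 2.
    by near: x'; apply: nbhsx_ballx; lra.
  have dh : d < h / 2 by near: d; apply: nbhs_right_lt; lra.
  have H1 : `|X x - X x'| < e / 2.
    by apply: (Hx x') => //; rewrite /ball_/=; lra.
  have H2 : `|X x - X s| < e / 2.
    apply: (Hx s) => //; rewrite /ball_/=.
    by rewrite (_ : x - s = (x - x') - (s - x')) ?(le_lt_trans (ler_normB _ _))//; lra.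
  rewrite (_ : X s - X x' = (X x - X x') - (X x - X s)); last by ring.
  by rewrite (le_lt_trans (ler_normB _ _))//; lra.
move=> Hd; near (0 : R)^'+ => d; exists d => // s t s0 st tT std.
rewrite distrC; have H : `[0, T] `<=` P d by near: d.
apply: H => //=; first by rewrite in_itv/= tT (le_trans s0).
by rewrite distrC ger0_norm ?subr_ge0.
Unshelve. all: by end_near. Qed.

Lemma unif_contW r r' g : r <= r' -> unif_cont r g -> unif_cont r' g.
Proof.
move=> rr' cg T e /(cg T)[d d0 H]; exists d => // s t rs.
by apply: H; exact: le_trans rs.
Qed.

Lemma unif_contN r g : unif_cont r g -> unif_cont r (\- g).
Proof.
move=> cg T e /(cg T)[d d0 H]; exists d => // s t rs st tT std.
by rewrite /= -opprD normrN H.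
Qed.

Lemma unif_contD r f g : unif_cont r f -> unif_cont r g ->
  unif_cont r (fun x => f x + g x).
Proof.
move=> cf cg T e e0; have e20 : 0 < e / 2 by lra.
have [d d0 H] := cf T _ e20; have [d' d'0 H'] := cg T _ e20.
exists (Num.min d d'); first by rewrite lt_min d0.
move=> s t rs st tT; rewrite lt_min => /andP[td td'].
have := H _ _ rs st tT td; have := H' _ _ rs st tT td'.
rewrite (_ : f t + g t - (f s + g s) = (f t - f s) + (g t - g s)); last by ring.
have := ler_normD (f t - f s) (g t - g s); lra.
Qed.

Lemma unif_contZ r k g : unif_cont r g -> unif_cont r (fun x => k * g x).
Proof.
move=> cg T e e0; have k0 : 0 < `|k| + 1 by rewrite ltr_pwDr.
have [d d0 H] := cg T _ (divr_gt0 e0 k0).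
exists d => // s t rs st tT td; have := H _ _ rs st tT td.
rewrite ltr_pdivlMr// -mulrBr normrM => /(le_lt_trans _); apply.
by rewrite mulrC ler_wpM2l// lerDl.
Qed.

Lemma unif_cont_at r g a e : unif_cont r g -> r <= a -> 0 < e ->
  exists2 d, 0 < d & forall s, r <= s -> `|s - a| < d -> `|g s - g a| < e.
Proof.
move=> cg ra e0; have [d d0 H] := cg (a + 1) e e0.
exists (Num.min d 1); first by rewrite lt_min d0 ltr01.
move=> s rs; rewrite lt_min => /andP[sd s1].
have [sa|/ltW as_] := leP s a.
  rewrite distrC; apply: H => //; first by lra.
  by move: sd; rewrite distrC ger0_norm// subr_ge0.
apply: H => //; move: sd s1; rewrite !ger0_norm ?subr_ge0//; lra.
Qed.

Lemma unif_cont_within a b g : unif_cont a g -> {within `[a, b], continuous g}.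
Proof.
move=> cg; apply/subspace_continuousP => x xab; apply/cvgrPdist_lt => e e0.
rewrite near_withinE.
have ax : a <= x by rewrite (itvP xab).
have [d d0 H] := unif_cont_at cg ax e0.
exists d => //= t; rewrite /ball_/= => xt; rewrite in_itv/= => /andP[at_ tb].
by rewrite distrC H// distrC.
Qed.

Lemma unif_cont_right r g t : unif_cont r g -> r <= t -> g x @[x --> t^'+] --> g t.
Proof.
move=> cg rt; apply/cvgrPdist_lt => e e0.
have [d d0 H] := unif_cont_at cg rt e0.
near=> x; have tx : t < x by [].
have xt : x - t < d by rewrite ltrBlDl; near: x; apply: nbhs_right_lt; lra.
by rewrite distrC H//; [lra|rewrite gtr0_norm ?subr_gt0].
Unshelve. all: by end_near. Qed.

Lemma unif_cont_left r g t : unif_cont r g -> r < t -> g x @[x --> t^'-] --> g t.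
Proof.
move=> cg rt; apply/cvgrPdist_lt => e e0.
have [d d0 H] := unif_cont_at cg (ltW rt) e0.
near=> x; have tx : x < t by [].
have rx : r < x by near: x; exact: nbhs_left_gt.
have xt : t - x < d by rewrite ltrBlDl -ltrBlDr; near: x; apply: nbhs_left_gt; lra.
by rewrite distrC H//; [lra|rewrite distrC gtr0_norm ?subr_gt0].
Unshelve. all: by end_near. Qed.

Lemma unif_cont_cadlag g : unif_cont 0 g -> cadlag g.
Proof.
move=> cg; split=> t t0; first exact: unif_cont_right cg t0.
by apply/cvg_ex; exists (g t); exact: unif_cont_left cg t0.
Qed.

Lemma unif_cont_jump g t : unif_cont 0 g -> jump g t = 0.
Proof.
move=> cg; rewrite /jump; case: ifPn => // t0.
by rewrite (cvg_lim _ (unif_cont_left cg t0))// subrr.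
Qed.

End continuity.

(** * Running extrema and first passage times *)
Section running_extrema.
Context {R : realType}.
Implicit Types (X : R -> R) (a b c e : R).

Lemma path_supN X a b : path_sup (\- X) a b = - path_inf X a b.
Proof.
rewrite /path_sup /path_inf /inf opprK; congr (sup _).
by rewrite image_comp.
Qed.

Lemma path_infN X a b : path_inf (\- X) a b = - path_sup X a b.
Proof.
rewrite /path_sup /path_inf /inf image_comp; congr (- sup _).
by apply: eq_imagel => x _ /=; rewrite opprK.
Qed.

Lemma path_supP X a b : unif_cont a X -> a <= b ->
  (exists2 p, a <= p <= b & path_sup X a b = X p) /\
  (forall q, a <= q <= b -> X q <= path_sup X a b).
Proof.
move=> cX ab; have [p pab Hp] := EVT_max ab (unif_cont_within (b := b) cX).
have ub : ubound (X @` `[a, b]) (X p) by move=> _ [q qab <-]; exact: Hp.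
have imp : (X @` `[a, b]) (X p) by exists p.
have E : path_sup X a b = X p.
  apply/eqP; rewrite eq_le ge_sup//=; last by exists (X p).
  by apply: ub_le_sup => //; exists (X p).
split; first by exists p => //; move: pab; rewrite in_itv.
by move=> q qab; rewrite E; apply: Hp; rewrite in_itv.
Qed.

Lemma path_infP X a b : unif_cont a X -> a <= b ->
  (exists2 p, a <= p <= b & path_inf X a b = X p) /\
  (forall q, a <= q <= b -> path_inf X a b <= X q).
Proof.
move=> /unif_contN cX ab; have := path_supP cX ab; rewrite path_supN.
move=> [[p pab Ep] H]; split; first by exists p => //; rewrite -[LHS]opprK Ep opprK.
by move=> q /H; rewrite lerN2.
Qed.

Lemma path_sup_split X a b c : unif_cont a X -> a <= b -> b <= c ->
  path_sup X a c = Num.max (path_sup X a b) (path_sup X b c).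
Proof.
move=> cX ab bc; have [[p pac Ep] Hac] := path_supP cX (le_trans ab bc).
have [[q qab Eq] Hab] := path_supP cX ab.
have [[r rbc Er] Hbc] := path_supP (unif_contW ab cX) bc.
apply/eqP; rewrite eq_le; apply/andP; split; last first.
  by rewrite ge_max Eq Er !Hac//; lra.
rewrite Ep le_max; have [pb|bp] := leP p b; first by rewrite Hab//; lra.
by rewrite Hbc ?orbT//; lra.
Qed.

Lemma path_inf_split X a b c : unif_cont a X -> a <= b -> b <= c ->
  path_inf X a c = Num.min (path_inf X a b) (path_inf X b c).
Proof.
move=> /unif_contN cX ab bc; apply: oppr_inj.
by rewrite oppr_min -!path_supN; exact: path_sup_split.
Qed.

Lemma path_sup1 X a : unif_cont a X -> path_sup X a a = X a.
Proof.
move=> cX; have [[p /andP[ap pa] ->] _] := path_supP cX (lexx a).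
by congr X; apply/eqP; rewrite eq_le ap pa.
Qed.

Lemma unif_cont_path_sup X a : unif_cont a X -> unif_cont a (path_sup X a).
Proof.
move=> cX T e e0; have [d d0 H] := cX T e e0.
exists d => // s t as_ st tT std.
have [[p pst Ep] Hst] := path_supP (unif_contW as_ cX) st.
have [_ Has] := path_supP cX as_.
have Xs : X s <= path_sup X a s by apply: Has; lra.
rewrite (path_sup_split cX as_ st) Ep.
have Xp : X p - X s < e.
  by apply: le_lt_trans (ler_norm _) _; apply: H; lra.
rewrite /Num.max; case: ifPn => [|_]; last by rewrite subrr normr0.
by move=> h; rewrite gtr0_norm; lra.
Qed.

End running_extrema.

Section first_times.
Context {R : realType}.
Implicit Types (X g : R -> R) (r a b c e K : R).

(** A continuous path sits exactly at the level at its first passage strictly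
    above it; this is what makes consecutive phases fit together. *)
Lemma first_timeP g r K : unif_cont r g -> g r <= K ->
  let tau := first_time [set s | r <= s /\ g s > K] in
  (tau = +oo%E /\ forall s, r <= s -> g s <= K) \/
  (exists a, [/\ tau = a%:E, r <= a, g a = K & forall s, r <= s <= a -> g s <= K]).
Proof.
move=> cg grK; set A := [set s | _]; move=> tau.
have tauP s : A s -> (tau <= s%:E)%E.
  by move=> As; apply: ereal_inf_lbound; exists s.
have rtau : (r%:E <= tau)%E.
  by apply: le_ereal_inf_tmp => _ [s [rs _] <-]; rewrite lee_fin.
have below s : r <= s -> (s%:E < tau)%E -> g s <= K.
  move=> rs st; rewrite leNgt; apply/negP => gs.
  by have := tauP s (conj rs gs); rewrite leNgt st.
case Etau : tau => [a| |]; last by move: rtau; rewrite Etau.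
- right; exists a; have ra : r <= a by move: rtau; rewrite Etau lee_fin.
  have gaK : g a <= K.
    rewrite leNgt; apply/negP => ga.
    have [e e0 ge] : exists2 e : R, 0 < e & e = g a - K by exists (g a - K) => //; real_lra.
    have [d d0 H] := unif_cont_at cg ra e0.
    have {}ra : r < a by rewrite lt_neqAle ra andbT; apply/eqP => E; rewrite E in grK; real_lra.
    pose s := Num.max r (a - d / 2).
    have rs : r <= s by rewrite le_max lexx.
    have sa : s < a by rewrite gt_max ra /=; real_lra.
    have das : a - d / 2 <= s by rewrite le_max lexx orbT.
    have : g s <= K by apply: below => //; rewrite Etau lte_fin.
    have := H s rs; rewrite distrC gtr0_norm ?subr_gt0// => /(_ ltac:(real_lra)).
    by rewrite ltr_norml => /andP[]; real_lra.
  split=> //.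
    apply/eqP; rewrite eq_le gaK leNgt; apply/negP => ga.
    have [e e0 ge] : exists2 e : R, 0 < e & e = K - g a by exists (K - g a) => //; real_lra.
    have [d d0 H] := unif_cont_at cg ra e0.
    have : (tau < (a + d)%:E)%E by rewrite Etau lte_fin; real_lra.
    move=> /ereal_inf_lt[_ [s [rs gs] <-]]; rewrite lte_fin => sd.
    have as_ : a <= s by rewrite -lee_fin -Etau; exact: tauP.
    have := H s rs; rewrite ger0_norm ?subr_ge0// => /(_ ltac:(real_lra)).
    by rewrite ltr_norml => /andP[]; real_lra.
  move=> s /andP[rs]; rewrite le_eqVlt => /predU1P[->//|sa].
  by apply: below => //; rewrite Etau lte_fin.
- by left; split=> // s rs; apply: below => //; rewrite Etau ltry.
Qed.

(** The running supremum first exceeds a level when the path does. Working with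
    the path gives the value [X 0 + c] of [X], not only of its supremum, at the
    end of the initial phase. *)
Lemma start_upE c X : unif_cont 0 X ->
  start_up c X = first_time [set s | 0 <= s /\ X s - X 0 > c].
Proof.
move=> cX; apply/eqP; rewrite eq_le; apply/andP; split.
  apply: ereal_inf_le_tmp; apply: image_subset => s [s0 Xs]; split=> //.
  have [_ /(_ s)] := path_supP cX s0; rewrite s0 lexx => /(_ isT); real_lra.
apply: le_ereal_inf_tmp => _ [s [s0 Xs] <-].
have [[p /andP[p0 ps] Ep] _] := path_supP cX s0.
apply: (@le_trans _ _ p%:E); last by rewrite lee_fin.
by apply: ereal_inf_lbound; exists p => //; split=> //; rewrite -Ep.
Qed.

Lemma start_downE c X : start_down c X = start_up c (\- X).
Proof.
congr first_time; apply/funext => s /=; rewrite path_supN.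
by rewrite (_ : - path_inf X 0 s - - X 0 = X 0 - path_inf X 0 s)//; ring.
Qed.

Lemma next_upE c X u : next_up c X u = next_down c (\- X) u.
Proof.
case: u => // r; congr first_time; apply/funext => s /=; rewrite path_supN.
by rewrite (_ : - path_inf X r s - - X s = X s - path_inf X r s)//; ring.
Qed.

End first_times.
(** * The phases of the construction *)
Section phases.
Context {R : realType}.
Implicit Types (X y : R -> R) (s t a b c e : R).

(** Rises and falls are exchanged by [X -> - X]. With this alternating sign the
    two interleaved sequences of times become one sequence [phase_time], the even
    phases being the upward ones, and every phase is treated as an upward one. *)
Definition alt X (n : nat) : R -> R := if odd n then \- X else X.

Definition alt_sign (n : nat) (x : R) : R := if odd n then - x else x.

Fixpoint phase_time c X (n : nat) : \bar R :=
  if n is m.+1 then next_down c (alt X m) (phase_time c X m) else start_up c X.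

Definition phase_value c X n s : R :=
  alt_sign n (path_sup (alt X n) (fine (phase_time c X n)) s - c).

Lemma altE X n t : alt X n t = alt_sign n (X t).
Proof. by rewrite /alt /alt_sign; case: ifP. Qed.

Lemma unif_cont_alt r X n : unif_cont r X -> unif_cont r (alt X n).
Proof. by rewrite /alt; case: ifP => // _; exact: unif_contN. Qed.

Lemma up_timeE c X k : up_time c X k = phase_time c X k.*2.
Proof. by elim: k => //= k ->; rewrite /alt /= odd_double /= next_upE. Qed.

Lemma down_timeE c X k : down_time c X k = phase_time c X k.*2.+1.
Proof. by rewrite /down_time up_timeE /= /alt odd_double. Qed.

Lemma reg_pieceE c X s v : reg_piece c X s v <->
  ((s%:E < phase_time c X 0)%E /\ v = X 0) \/
  exists n, (phase_time c X n <= s%:E < phase_time c X n.+1)%E /\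
    v = phase_value c X n s.
Proof.
split=> [[[H ->]|[k [H ->]]|[k [H ->]]]|[[H ->]|[n [H ->]]]].
- by left.
- right; exists k.*2; rewrite -up_timeE -down_timeE; split=> //.
  by rewrite /phase_value /alt_sign /alt odd_double -up_timeE.
- right; exists k.*2.+1; rewrite -down_timeE -doubleS -up_timeE; split=> //.
  have odd1 : odd k.*2.+1 by rewrite /= odd_double.
  by rewrite /phase_value /alt_sign /alt odd1 -down_timeE path_supN; ring.
- by constructor 1.
- have En := odd_double_half n; case: (boolP (odd n)) => on.
    have {}En : n = (n./2).*2.+1 by rewrite -[LHS]En on.
    constructor 3; exists (n./2); rewrite down_timeE up_timeE doubleS -En; split=> //.
    by rewrite /phase_value /alt_sign /alt on path_supN; ring.
  have {}En : n = (n./2).*2 by rewrite -[LHS]En (negbTE on).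
  constructor 2; exists (n./2); rewrite down_timeE up_timeE -En; split=> //.
  by rewrite /phase_value /alt_sign /alt (negbTE on).
Qed.

Section one_path.
Variables (c : R) (X : R -> R).
Hypotheses (c_gt0 : 0 < c) (cX : unif_cont 0 X).
Let tau := phase_time c X.

Lemma phase_timeP n a : tau n = a%:E -> 0 <= a ->
  (tau n.+1 = +oo%E /\
    forall s, a <= s -> path_sup (alt X n) a s - alt X n s <= 2 * c) \/
  (exists b, [/\ tau n.+1 = b%:E, a < b,
     path_sup (alt X n) a b - alt X n b = 2 * c &
     forall s, a <= s <= b -> path_sup (alt X n) a s - alt X n s <= 2 * c]).
Proof.
move=> Ea a0; have c0 := c_gt0; have cXa := unif_contW a0 (unif_cont_alt n cX).
have cg : unif_cont a (fun s => path_sup (alt X n) a s - alt X n s).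
  exact: unif_contD (unif_cont_path_sup cXa) (unif_contN cXa).
have ga0 : path_sup (alt X n) a a - alt X n a = 0 by rewrite path_sup1// subrr.
have ga : path_sup (alt X n) a a - alt X n a <= 2 * c by real_lra.
have -> : tau n.+1 =
    first_time [set s | a <= s /\ path_sup (alt X n) a s - alt X n s > 2 * c].
  by rewrite /tau/= -/(tau n) Ea.
case: (first_timeP cg ga) => [[-> H]|[b [-> ab Hb H]]]; [by left|right].
exists b; split=> //; rewrite lt_neqAle ab andbT; apply/eqP => E.
by move: Hb; rewrite -E ga0; real_lra.
Qed.

Lemma phase_time0P :
  (tau 0 = +oo%E /\ forall s, 0 <= s -> X s - X 0 <= c) \/
  (exists a, [/\ tau 0 = a%:E, 0 <= a, X a - X 0 = c &
     forall s, 0 <= s <= a -> X s - X 0 <= c]).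
Proof.
have -> : tau 0 = first_time [set s | 0 <= s /\ X s - X 0 > c] by exact: start_upE.
have cg : unif_cont 0 (fun s => X s - X 0).
  by move=> T e /(cX T)[d d0 H]; exists d => // s t *; rewrite opprB addrA subrK H.
by apply: first_timeP => //; rewrite subrr ltW.
Qed.

Lemma phase_time_ge0 n a : tau n = a%:E -> 0 <= a.
Proof.
elim: n a => [|n IH] a Ea.
  by case: phase_time0P => [[E _]|[b [E b0 _ _]]]; move: E; rewrite Ea// => -[->].
case En : (tau n) => [b| |].
- case: (phase_timeP En (IH _ En)) => [[E _]|[d [E bd _ _]]]; move: E; rewrite Ea// => -[->].
  by rewrite (le_trans (IH _ En))// ltW.
- by move: Ea; rewrite /tau/= -/(tau n) En.
- by move: Ea; rewrite /tau/= -/(tau n) En.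
Qed.

Lemma phase_timeS n : (tau n <= tau n.+1)%E.
Proof.
case En : (tau n) => [b| |]; rewrite ?leNye//.
  case: (phase_timeP En (phase_time_ge0 En)) => [[-> _]|[d [-> bd _ _]]].
    by rewrite leey.
  by rewrite lee_fin ltW.
by rewrite /tau/= -/(tau n) En.
Qed.

Lemma phase_time_nd n m : (n <= m)%N -> (tau n <= tau m)%E.
Proof.
move=> /subnKC <-; elim: (m - n)%N => [|k IH]; first by rewrite addn0.
by rewrite addnS (le_trans IH)// phase_timeS.
Qed.

(** During a complete phase [X] moves by [2 * c], so phases starting before [t]
    have a length bounded below by the modulus of continuity of [X] on [0, t]. *)
Lemma phase_time_unbounded t : exists n, (t%:E < tau n)%E.
Proof.
have c0 := c_gt0; apply/not_existsP => H.
have {}H n : (tau n <= t%:E)%E by rewrite leNgt; exact/negP.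
have c20 : 0 < 2 * c by real_lra.
have [d d0 Hd] := cX t c20.
have fin n : exists2 a, tau n = a%:E & d * n%:R <= a /\ a <= t.
  elim: n => [|n [a Ea [na at_]]].
    have := H 0%N; case: phase_time0P => [[-> _]|[b [-> b0 _ _]]] //.
    by rewrite lee_fin; exists b; rewrite ?mulr0.
  have a0 := phase_time_ge0 Ea; have := H n.+1.
  case: (phase_timeP Ea a0) => [[-> _]//|[b [-> ab Hb _]]].
  rewrite lee_fin => bt; exists b => //; split=> //.
  have [[p pab Ep] _] := path_supP (unif_contW a0 (unif_cont_alt n cX)) (ltW ab).
  have pb : d <= b - p.
    rewrite leNgt; apply/negP => /Hd.
    rewrite distrC => /(_ ltac:(real_lra) ltac:(real_lra) bt); move: Hb; rewrite Ep !altE /alt_sign.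
    by case: ifP => _ Hb; rewrite ltr_norml => /andP[]; real_lra.
  rewrite -addn1 natrD mulrDr mulr1; real_lra.
have [a _ [H1 H2]] := fin (Num.truncn (t / d)).+1.
have := truncnS_gt (t / d); rewrite ltr_pdivrMr// mulrC; real_lra.
Qed.

Lemma reg_up_start s : (s%:E < tau 0)%E -> reg_up c X s = X 0.
Proof.
move=> s0; rewrite /reg_up; case: xgetP => [y _ /reg_pieceE[[_ ->]//|[n]]|/(_ (X 0))[]].
  move=> [/andP[ns _] _]; have := phase_time_nd (leq0n n); rewrite leNgt.
  by rewrite (le_lt_trans ns s0).
by apply/reg_pieceE; left.
Qed.

Lemma reg_up_phase n s : (tau n <= s%:E < tau n.+1)%E ->
  reg_up c X s = phase_value c X n s.
Proof.
move=> /[dup] ns /andP[n1 n2]; rewrite /reg_up; case: xgetP; last first.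
  by move=> /(_ (phase_value c X n s))[]; apply/reg_pieceE; right; exists n.
move=> y _ /reg_pieceE[[s0 _]|[m [/andP[m1 m2] ->]]].
  have := phase_time_nd (leq0n n); rewrite leNgt.
  by rewrite (le_lt_trans n1 s0).
suff -> : m = n by [].
apply/eqP; rewrite eqn_leq; apply/andP; split; rewrite leqNgt; apply/negP => mn.
  by have := phase_time_nd mn; rewrite leNgt (le_lt_trans m1 n2).
by have := phase_time_nd mn; rewrite leNgt (le_lt_trans n1 m2).
Qed.

Lemma reg_up_at_phase n b : tau n = b%:E -> reg_up c X b = X b - alt_sign n c.
Proof.
move=> Eb; have b0 := phase_time_ge0 Eb; rewrite (@reg_up_phase n).
  rewrite /phase_value -/tau Eb/= path_sup1; last exact: unif_contW (unif_cont_alt n cX).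
  by rewrite altE /alt_sign; case: (odd n); ring.
rewrite Eb lexx/=.
by case: (phase_timeP Eb b0) => [[-> _]|[d [-> bd _ _]]]; rewrite ?ltry ?lte_fin.
Qed.

(** The formula of a phase extends to its right end point, where it agrees with
    the value [X b - alt_sign n.+1 c] that the next phase prescribes. *)
Lemma reg_up_closed n a s : tau n = a%:E -> a <= s -> (s%:E <= tau n.+1)%E ->
  reg_up c X s = alt_sign n (path_sup (alt X n) a s - c).
Proof.
move=> Ea as_; rewrite le_eqVlt => /predU1P[Es|sn]; last first.
  by rewrite (@reg_up_phase n) ?Ea ?lee_fin ?as_// /phase_value -/tau Ea.
rewrite (reg_up_at_phase (esym Es)).
case: (phase_timeP Ea (phase_time_ge0 Ea)) => [[E _]|[b [E ab Hb _]]].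
  by rewrite E in Es.
move: Hb; have -> : b = s by move: E; rewrite -Es => -[].
by rewrite altE /alt_sign /=; case: (odd n) => /=; real_lra.
Qed.

End one_path.
End phases.

(** * The play rule *)
Section play.
Context {R : realType}.
Implicit Types (X y : R -> R) (s t r a b c e : R).

Definition clamp (l u x : R) : R := Num.max l (Num.min u x).

Lemma clamp_id l u x : l <= x -> x <= u -> clamp l u x = x.
Proof. by move=> lx xu; rewrite /clamp min_r// max_r. Qed.

Lemma clamp_cases l u x : l <= u ->
  [\/ x <= l /\ clamp l u x = l, l <= x <= u /\ clamp l u x = x |
      u <= x /\ clamp l u x = u].
Proof.
move=> lu; have [xl|/ltW lx] := leP x l.
  by constructor 1; split=> //; rewrite /clamp min_r ?max_l// (le_trans xl).
have [xu|/ltW ux] := leP x u; first by constructor 2; rewrite clamp_id// lx.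
by constructor 3; split=> //; rewrite /clamp min_l// max_r.
Qed.

(** Clamping successively to two overlapping intervals is clamping to their
    intersection: this is why the play rule can be iterated. *)
Lemma clamp_comp l1 u1 l2 u2 x : l1 <= u2 ->
  clamp l2 u2 (clamp l1 u1 x) = clamp (Num.max l1 l2) (Num.min u1 u2) x.
Proof.
move=> l1u2; rewrite /clamp min_maxr (min_r l1u2) minA maxA (maxC l2 l1).
by rewrite (minC u1).
Qed.

Lemma clampN l u x : l <= u -> clamp (- u) (- l) (- x) = - clamp l u x.
Proof.
move=> lu; rewrite /clamp oppr_max oppr_min min_maxr; congr Num.max.
by rewrite min_r// lerN2.
Qed.

(** The bound on the oscillation says that the interval to which [y s] is
    clamped is not empty. *)
Definition play_on c X y a b : Prop := forall s t, a <= s -> s <= t -> t <= b ->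
  path_sup X s t - path_inf X s t <= 2 * c ->
  y t = clamp (path_sup X s t - c) (path_inf X s t + c) (y s).

Definition play c X y : Prop := forall b, play_on c X y 0 b.

Lemma play_on_cat c X y a b d : unif_cont a X ->
  play_on c X y a b -> play_on c X y b d -> play_on c X y a d.
Proof.
move=> cX yab ybd s t as_ st td.
have [tb|/ltW bt] := leP t b; first exact: yab.
have [bs|/ltW sb] := leP b s; first exact: ybd.
have cs := unif_contW as_ cX.
rewrite (path_sup_split cs sb bt) (path_inf_split cs sb bt) => osc.
have osc12 : path_sup X s b - path_inf X b t <= 2 * c.
  apply: le_trans osc; apply: lerB; first by rewrite le_max lexx.
  by rewrite ge_min lexx orbT.
have osc11 : path_sup X s b - path_inf X s b <= 2 * c.
  apply: le_trans osc; apply: lerB; first by rewrite le_max lexx.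
  by rewrite ge_min lexx.
have osc22 : path_sup X b t - path_inf X b t <= 2 * c.
  apply: le_trans osc; apply: lerB; first by rewrite le_max lexx orbT.
  by rewrite ge_min lexx orbT.
rewrite (ybd b t)// (yab s b)// clamp_comp; last by lra.
by rewrite addr_maxl addr_minl.
Qed.

Lemma play_onN c X y a b : play_on c X y a b -> play_on c (\- X) (\- y) a b.
Proof.
move=> H s t as_ st tb; rewrite path_supN path_infN => osc.
rewrite /= (H s t)//; last by lra.
by rewrite -clampN; [congr clamp; lra|lra].
Qed.

(** In an upward phase the running supremum since the start of the phase can only
    be pushed up, so the lower bound of the clamp is the only active one. *)
Lemma play_on_up c X y a b : unif_cont a X ->
  (forall r, a <= r <= b -> y r = path_sup X a r - c) ->
  (forall r, a <= r <= b -> path_sup X a r - X r <= 2 * c) ->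
  play_on c X y a b.
Proof.
move=> cX yE low s t as_ st tb _.
rewrite !yE; [|lra|lra]; rewrite (path_sup_split cX as_ st).
have [[q qst Eq] _] := path_infP (unif_contW as_ cX) st.
have := low q; rewrite Eq (@path_sup_split _ _ a s q)//; try lra.
rewrite lerBlDl ge_max => /(_ ltac:(lra)) /andP[H _].
by rewrite /clamp min_r ?addr_maxl 1?maxC//; lra.
Qed.

Lemma play_on_cst c X y a b x : unif_cont a X ->
  (forall r, a <= r <= b -> y r = x) ->
  (forall r, a <= r <= b -> x - c <= X r <= x + c) ->
  play_on c X y a b.
Proof.
move=> cX yE low s t as_ st tb _.
rewrite !yE; [|lra|lra].
have [[q qst Eq] _] := path_infP (unif_contW as_ cX) st.
have [[p pst Ep] _] := path_supP (unif_contW as_ cX) st.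
have := low q ltac:(lra); have := low p ltac:(lra).
by move=> Hp Hq; rewrite Eq Ep clamp_id//; lra.
Qed.

Lemma play_on_phase c X n a b : 0 < c -> unif_cont 0 X ->
  phase_time c X n = a%:E -> (b%:E <= phase_time c X n.+1)%E ->
  play_on c X (reg_up c X) a b.
Proof.
move=> c0 cX Ea bn; have a0 := phase_time_ge0 c0 cX Ea.
have yE r : a <= r <= b -> reg_up c X r = alt_sign n (path_sup (alt X n) a r - c).
  move=> /andP[ar rb]; apply: reg_up_closed => //.
  by apply: le_trans bn; rewrite lee_fin.
have low r : a <= r <= b -> path_sup (alt X n) a r - alt X n r <= 2 * c.
  move=> /andP[ar rb]; case: (phase_timeP c0 cX Ea a0) => [[_]|[d [Ed _ _]]].
    by apply.
  by apply; rewrite ar; move: bn; rewrite Ed lee_fin; exact: le_trans.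
have cXa := unif_contW a0 cX.
move: yE low; rewrite /alt /alt_sign; case: ifP => _ yE low; last exact: play_on_up.
have /play_onN : play_on c (\- X) (\- reg_up c X) a b.
  apply: play_on_up low; first exact: unif_contN.
  by move=> r /yE E; rewrite /= E opprK.
have opp2 (f : R -> R) : \- (\- f) = f by apply/funext => z /=; rewrite opprK.
by rewrite !opp2.
Qed.

Lemma start_up_ge0 c X : 0 < c -> unif_cont 0 X -> (0%:E <= start_up c X)%E.
Proof.
move=> c0 cX; rewrite -[start_up c X]/(phase_time c X 0).
by case: (phase_time0P c0 cX) => [[-> _]|[a [-> a0 _ _]]]; rewrite ?leey ?lee_fin.
Qed.

Lemma play_on_start c X b : 0 < c -> unif_cont 0 X ->
  (start_up c X <= start_down c X)%E -> (b%:E <= start_up c X)%E ->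
  play_on c X (reg_up c X) 0 b /\ reg_up c X 0 = X 0.
Proof.
move=> c0 cX updown bup.
have yE r : 0 <= r -> (r%:E <= start_up c X)%E -> reg_up c X r = X 0.
  move=> r0; rewrite le_eqVlt => /predU1P[Er|]; last first.
    by move=> rup; rewrite (reg_up_start c0 cX).
  have Er' : phase_time c X 0 = r%:E by [].
  rewrite (reg_up_at_phase c0 cX Er') /alt_sign /=.
  case: (phase_time0P c0 cX) => [[E _]|[a [E _ Xa _]]]; rewrite E in Er'; case: Er' => //.
  by move=> <-; lra.
have up r : 0 <= r -> (r%:E <= start_up c X)%E -> X r - X 0 <= c.
  move=> r0 rup; case: (phase_time0P c0 cX) => [[_ H]|[a [E _ _ H]]]; apply: H => //.
  by rewrite r0 -lee_fin (le_trans rup)// -E.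
have down r : 0 <= r -> (r%:E <= start_up c X)%E -> X 0 - X r <= c.
  move=> r0 rup; have {}rup := le_trans rup updown.
  have cNX := unif_contN cX; rewrite start_downE in rup.
  have : (\- X) r - (\- X) 0 <= c.
    case: (phase_time0P c0 cNX) => [[_ H]|[a [E _ _ H]]]; apply: H => //.
    by rewrite r0 -lee_fin (le_trans rup)// -E.
  by rewrite /=; real_lra.
have start0 : (0%:E <= start_up c X)%E.
  exact: start_up_ge0.
split; last exact: yE.
apply: (@play_on_cst _ _ _ _ _ (X 0)) => // r /andP[r0 rb].
  by apply: yE => //; apply: le_trans bup; rewrite lee_fin.
have rup : (r%:E <= start_up c X)%E by apply: le_trans bup; rewrite lee_fin.
have := up r r0 rup; have := down r r0 rup; real_lra.
Qed.

Lemma play_reg_up c X : 0 < c -> unif_cont 0 X ->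
  (start_up c X <= start_down c X)%E ->
  play c X (reg_up c X) /\ reg_up c X 0 = X 0.
Proof.
move=> c0 cX updown; split; last first.
  have := start_up_ge0 c0 cX.
  by move=> /(play_on_start c0 cX updown)[].
move=> b; have [n /ltW] := phase_time_unbounded c0 cX b.
elim: n b => [b|n IH b bn]; first by move=> /(play_on_start c0 cX updown)[].
have [/IH//|nb] := leP b%:E (phase_time c X n).
case En : (phase_time c X n) => [a| |].
- apply: (@play_on_cat _ _ _ _ a) => //; first by apply: IH; rewrite En.
  exact: play_on_phase c0 cX En bn.
- by move: nb; rewrite En.
- have := le_trans (start_up_ge0 c0 cX) (phase_time_nd c0 cX (leq0n n)).
  by rewrite En.
Qed.

(** The rule is invariant under [X -> - X], so the case in which the first phase
    is downward reduces to the other one. *)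
Lemma play_reg c X : 0 < c -> unif_cont 0 X ->
  play c X (reg c X) /\ reg c X 0 = X 0.
Proof.
move=> c0 cX; rewrite /reg; case: ifPn => [|]; first exact: play_reg_up.
rewrite -ltNge => downup; have cNX := unif_contN cX.
have opp2 (f : R -> R) : \- (\- f) = f by apply/funext => z /=; rewrite opprK.
have updownN : (start_up c (\- X)%R <= start_down c (\- X)%R)%E.
  by rewrite start_downE opp2 -start_downE ltW.
have [H H0] := play_reg_up c0 cNX updownN.
split; last by rewrite /= H0 opprK.
by move=> b; rewrite -[X]opp2; apply: play_onN; rewrite opp2.
Qed.

End play.

(** * Consequences of the play rule *)
Ltac clamp_lra := match goal with
  | |- context [clamp ?l ?u ?x] =>
      let H := fresh in
      have H := @clamp_cases _ l u x ltac:(lra);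
      case: H => -[? ->]; lra
  end.

Section play_theory.
Context {R : realType}.
Implicit Types (X y : R -> R) (s t r a b c e : R).

Definition osc_le X s t e : Prop :=
  forall p q, s <= p <= t -> s <= q <= t -> X p - X q <= e.

Lemma osc_leS X s t s' t' e : s <= s' -> t' <= t -> osc_le X s t e -> osc_le X s' t' e.
Proof. by move=> ss tt H p q pst qst; apply: H; lra. Qed.

Lemma osc_le_unif X T e : unif_cont 0 X -> 0 < e ->
  exists2 d, 0 < d & forall s t, 0 <= s -> t <= T -> t - s < d -> osc_le X s t e.
Proof.
move=> cX e0; have [d d0 H] := cX T e e0; exists d => // s t s0 tT td p q pst qst.
have [pq|/ltW qp] := leP p q.
  have := H p q ltac:(lra) pq ltac:(lra) ltac:(lra).
  by rewrite ltr_norml => /andP[]; lra.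
have := H q p ltac:(lra) qp ltac:(lra) ltac:(lra).
by rewrite ltr_norml => /andP[]; lra.
Qed.

(** The play rule with the supremum and infimum replaced by points where they are
    attained, the form in which it can be used by linear arithmetic. *)
Lemma play_step c X y s t e : unif_cont 0 X -> play c X y ->
  0 <= s -> s <= t -> osc_le X s t e -> e <= 2 * c ->
  exists p q, [/\ s <= p <= t, s <= q <= t,
    forall r, s <= r <= t -> X q <= X r <= X p &
    y t = clamp (X p - c) (X q + c) (y s)].
Proof.
move=> cX yP s0 st osc e2; have cs := unif_contW s0 cX.
have [[p pst Ep] Hp] := path_supP cs st; have [[q qst Eq] Hq] := path_infP cs st.
exists p, q; split=> //.
  by move=> r rst; rewrite -Eq -Ep Hq// Hp.
rewrite -Eq -Ep; apply: (yP t) => //; rewrite Ep Eq.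
by have := osc p q pst qst; lra.
Qed.

Lemma play_close c X y s : 0 < c -> unif_cont 0 X -> play c X y -> 0 <= s ->
  X s - c <= y s <= X s + c.
Proof.
move=> c0 cX yP s0; have eqs z : s <= z <= s -> z = s by rewrite -eq_le => /eqP.
have osc : osc_le X s s 0 by move=> p q /eqs-> /eqs->; rewrite subrr.
have [p [q [ps qs _ ->]]] := play_step cX yP s0 (lexx s) osc ltac:(lra).
rewrite (eqs _ ps) (eqs _ qs).
by clamp_lra.
Qed.

Lemma play_osc c X y s t e : 0 < c -> unif_cont 0 X -> play c X y ->
  0 <= s -> s <= t -> osc_le X s t e -> e <= 2 * c -> `|y t - y s| <= e.
Proof.
move=> c0 cX yP s0 st osc e2.
have [p [q [ps qs H ->]]] := play_step cX yP s0 st osc e2.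
have ys := play_close c0 cX yP s0.
have op := osc p s ps ltac:(lra); have oq := osc s q ltac:(lra) qs.
have os := osc s s ltac:(lra) ltac:(lra); have opq := osc p q ps qs.
by rewrite ler_norml; clamp_lra.
Qed.

Lemma play_unif c X y : 0 < c -> unif_cont 0 X -> play c X y -> unif_cont 0 y.
Proof.
move=> c0 cX yP T e e0; have [d d0 H] := osc_le_unif T cX (e := Num.min (e / 2) (2 * c))
  ltac:(rewrite lt_min; lra).
exists d => // s t s0 st tT td; apply: le_lt_trans (_ : Num.min (e / 2) (2 * c) < e).
  by apply: (play_osc c0 cX yP s0 st (H _ _ s0 tT td)); rewrite ge_min lexx orbT.
by rewrite gt_min; lra.
Qed.

(** If [y s] is above [sup X - c] at the start, so is [y] throughout and it can only
    go down; otherwise [y] stays below [inf X + c] and can only go up. *)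
Lemma play_monotone c X y s t e : 0 < c -> unif_cont 0 X -> play c X y ->
  0 <= s -> s <= t -> osc_le X s t e -> e <= 2 * c ->
  {in `[s, t] &, {homo y : r r' / r <= r'}} \/
  {in `[s, t] &, {homo y : r r' /~ r <= r'}}.
Proof.
move=> c0 cX yP s0 st osc e2.
have [p [q [ps qs H _]]] := play_step cX yP s0 st osc e2.
have pq := osc p q ps qs.
have [low|up] := leP (X p - c) (y s); [right|left].
  have yr r : s <= r <= t -> X p - c <= y r.
    move=> /andP[sr rt].
    have [p' [q' [ps' qs' H' ->]]] := play_step cX yP s0 sr (osc_leS (lexx s) rt osc) e2.
    have Hp' := H p' ltac:(lra); have Hq' := H q' ltac:(lra).
    by clamp_lra.
  move=> r' r; rewrite !in_itv/= => r'st rst rr'.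
  have yrr := yr r rst; have r0 : 0 <= r by lra.
have osc' : osc_le X r r' e by apply: osc_leS osc; lra.
  have [p' [q' [ps' qs' H' ->]]] := play_step cX yP r0 rr' osc' e2.
  have Hp' := H p' ltac:(lra); have Hq' := H q' ltac:(lra).
  by clamp_lra.
have yr r : s <= r <= t -> y r <= X q + c.
  move=> /andP[sr rt].
  have [p' [q' [ps' qs' H' ->]]] := play_step cX yP s0 sr (osc_leS (lexx s) rt osc) e2.
  have Hp' := H p' ltac:(lra); have Hq' := H q' ltac:(lra).
  by clamp_lra.
move=> r r'; rewrite !in_itv/= => rst r'st rr'.
have yrr := yr r rst; have r0 : 0 <= r by lra.
have osc' : osc_le X r r' e by apply: osc_leS osc; lra.
have [p' [q' [ps' qs' H' ->]]] := play_step cX yP r0 rr' osc' e2.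
have Hp' := H p' ltac:(lra); have Hq' := H q' ltac:(lra).
by clamp_lra.
Qed.

(** The source of the divergence. If [y] increases from [s] to [t], then
    [y t = sup X - c], so [y s <= y t <= X s + e - c], whereas [z] is at least
    [X s - c / 2]; and symmetrically. *)
Lemma play_gap c X y s t e z : 0 < c -> unif_cont 0 X -> play c X y ->
  0 <= s -> s <= t -> osc_le X s t e -> e <= 2 * c -> `|z - X s| <= c / 2 ->
  (c / 2 - e) * `|y t - y s| <= (z - y s) * (y t - y s).
Proof.
move=> c0 cX yP s0 st osc e2; rewrite ler_norml => zX.
have [p [q [ps qs H E]]] := play_step cX yP s0 st osc e2.
have ys := play_close c0 cX yP s0.
have op := osc p s ps ltac:(lra); have oq := osc s q ltac:(lra) qs.
have opq := osc p q ps qs.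
have [D|D|D] := ltgtP (y t) (y s).
- rewrite ltr0_norm ?subr_lt0// mulrN -mulNr ler_wnM2r; first by lra.
    by lra.
  suff : y t = X q + c by lra.
  by move: D; rewrite E; clamp_lra.
- rewrite gtr0_norm ?subr_gt0// ler_wpM2r; first by lra.
    by lra.
  suff : y t = X p - c by lra.
  by move: D; rewrite E; clamp_lra.
- by rewrite D subrr normr0 !mulr0.
Qed.

Fixpoint discrete_play c (x : nat -> R) (n : nat) : R :=
  if n is m.+1 then clamp (x n - c) (x n + c) (discrete_play c x m) else x 0%N.

(** Clamping contracts distances, so the errors made at the successive steps do
    not add up: the error remains the largest oscillation over one step. *)
Lemma discrete_play_close c X y h e n : 0 < c -> unif_cont 0 X -> play c X y ->
  y 0 = X 0 -> 0 <= h -> 0 <= e -> e <= 2 * c ->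
  (forall i, (i < n)%N -> osc_le X (i%:R * h) (i.+1%:R * h) e) ->
  `|discrete_play c (fun i => X (i%:R * h)) n - y (n%:R * h)| <= e.
Proof.
move=> c0 cX yP y0 h0 e0 e2; elim: n => [|n IH] osc.
  by rewrite /= mul0r y0 subrr normr0.
have {}IH := IH (fun i ni => osc i (ltnW ni)).
have s0 : 0 <= n%:R * h by rewrite mulr_ge0.
have st : n%:R * h <= n.+1%:R * h by rewrite ler_wpM2r// ler_nat.
have oscn := osc n (ltnSn n).
have [p [q [ps qs H E]]] := play_step cX yP s0 st oscn e2.
rewrite /discrete_play -/(discrete_play _ _) E.
have opq := oscn _ _ ps qs; move: IH opq; rewrite !ler_norml.
have st' : n%:R * h <= n.+1%:R * h <= n.+1%:R * h by rewrite st lexx.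
have := H _ st'; have := oscn _ _ ps st'; have := oscn _ _ st' qs.
move: (X p) (X q) (X (n.+1%:R * h)) (discrete_play _ _ _) (y _).
move=> xp xq x z w H1 H2 H3 H4 H5.
have [[? ->]|[? ->]|[? ->]] := @clamp_cases _ (x - c) (x + c) z ltac:(lra);
  clamp_lra.
Qed.

Lemma discrete_play_cvg c X y t : 0 < c -> unif_cont 0 X -> play c X y ->
  y 0 = X 0 -> 0 <= t ->
  discrete_play c (fun i => X (i%:R * (t / N.+1%:R))) N.+1 @[N --> \oo] --> y t.
Proof.
move=> c0 cX yP y0 t0; apply/cvgrPdist_le => e e0.
pose e' := Num.min e (2 * c).
have e'0 : 0 < e' by rewrite lt_min; lra.
have e'e : e' <= e by rewrite ge_min lexx.
have e'c : e' <= 2 * c by rewrite ge_min lexx orbT.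
have [d d0 H] := osc_le_unif t cX e'0.
near=> N; rewrite distrC; apply: le_trans e'e.
have N0 : (N.+1%:R : R) != 0 by rewrite pnatr_eq0.
rewrite -[in X in _ - X](@divfK _ N.+1%:R N0 t) [in X in y X]mulrC.
have h0 : 0 <= t / N.+1%:R by rewrite divr_ge0.
apply: discrete_play_close => //; first exact: ltW.
move=> i iN; apply: H; first by rewrite mulr_ge0.
  rewrite -[leRHS](@divfK _ N.+1%:R N0 t) [leRHS]mulrC.
  by rewrite ler_wpM2r// ler_nat.
rewrite -mulrBl -natrB// subSnn mul1r ltr_pdivrMr ?ltr0n// -ltr_pdivrMl// mulrC.
apply: (@lt_le_trans _ _ N%:R); last by rewrite ler_nat.
near: N; exact: nbhs_infty_gtr.
Unshelve. all: by end_near. Qed.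

Lemma nonincreasing_bounded_variation a b (f : R -> R) :
  {in `[a, b] &, {homo f : x y /~ x <= y}} -> bounded_variation a b f.
Proof.
move=> H; have /nondecreasing_bounded_variation/bounded_variationN :
    {in `[a, b] &, {homo (\- f) : x y / x <= y}}.
  by move=> x y xab yab xy /=; rewrite lerN2; exact: H.
by congr bounded_variation; apply/funext => x /=; rewrite opprK.
Qed.

Lemma bounded_variation_steps a h n (f : R -> R) : 0 <= h ->
  (forall i, (i < n)%N -> bounded_variation (a + i%:R * h) (a + i.+1%:R * h) f) ->
  bounded_variation a (a + n%:R * h) f.
Proof.
move=> h0; elim: n => [|n IH] H.
  by rewrite mul0r addr0; exact: bounded_variationxx.
have an : a <= a + n%:R * h by rewrite lerDl mulr_ge0.
have nn : a + n%:R * h <= a + n.+1%:R * h by rewrite lerD2l ler_wpM2r// ler_nat.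
apply/bounded_variationP; first exact: le_trans nn.
rewrite (total_variationD _ an nn) fin_numD; apply/andP; split.
  by apply/bounded_variationP => //; apply: IH => i /ltnW; exact: H.
by apply/bounded_variationP => //; exact: H.
Qed.

Lemma play_bounded_variation c X y k T : 0 < c -> unif_cont 0 X -> play c X y ->
  0 <= T -> bounded_variation 0 T (fun t => k * y t).
Proof.
move=> c0 cX yP T0; have [d d0 H] := osc_le_unif T cX (e := 2 * c) ltac:(lra).
pose N := (Num.truncn (T / d)).+1.
have N0 : (N%:R : R) != 0 by rewrite pnatr_eq0.
pose h := T / N%:R; have h0 : 0 <= h by rewrite divr_ge0.
have hd : h < d.
  by rewrite /h ltr_pdivrMr ?ltr0n// -ltr_pdivrMl// mulrC truncnS_gt.
have E : T = 0 + N%:R * h by rewrite add0r /h mulrC divfK.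
rewrite [X in bounded_variation _ X]E; apply: bounded_variation_steps => // i iN.
rewrite !add0r.
have s0 : 0 <= i%:R * h by rewrite mulr_ge0.
have st : i%:R * h <= i.+1%:R * h by rewrite ler_wpM2r// ler_nat.
have tT : i.+1%:R * h <= T by rewrite E add0r ler_wpM2r// ler_nat.
have osc : osc_le X (i%:R * h) (i.+1%:R * h) (2 * c).
  by apply: H => //; rewrite -mulrBl -natrB// subSnn mul1r.
have [m|m] := play_monotone c0 cX yP s0 st osc (lexx _);
  have [k0|/ltW k0] := leP 0 k.
- apply: nondecreasing_bounded_variation => r r' rs r's rr'.
  by rewrite ler_wpM2l// m.
- apply: nonincreasing_bounded_variation => r r' rs r's rr'.
  by rewrite ler_wnM2l// m.
- apply: nonincreasing_bounded_variation => r r' rs r's rr'.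
  by rewrite ler_wpM2l// m.
- apply: nondecreasing_bounded_variation => r r' rs r's rr'.
  by rewrite ler_wnM2l// m.
Qed.

End play_theory.

(** * Stieltjes integrals as limits of Riemann sums *)
Section stieltjes.
Context {R : realType}.
Implicit Types (f g y : R -> R) (u : cumulative R R) (a b e : R).

(** The extension is constant outside [a, b]. *)
Lemma cumulative_extension g a b : a <= b ->
  {in `[a, b] &, {homo g : s t / s <= t}} ->
  (forall x, a <= x < b -> g t @[t --> x^'+] --> g x) ->
  exists u : cumulative R R, forall t, a <= t <= b -> u t = g t.
Proof.
move=> ab ndg rcg; pose h t := g (clamp a b t).
have clampI t : a <= clamp a b t <= b.
  by rewrite /clamp le_max lexx ge_max ab ge_min lexx.
have ndh : nondecreasing h.
  move=> s t st; apply: ndg; rewrite ?in_itv//= /clamp ge_max !le_max lexx/=.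
  by rewrite le_min !ge_min lexx st !orbT.
have rch : right_continuous h.
  move=> x; have [xa|ax] := ltP x a.
    apply: cvg_near_cst; near=> t.
    have ta : t < a by near: t; exact: nbhs_right_lt.
    rewrite /h /clamp (min_r (ltW (lt_le_trans xa ab))).
    by rewrite (min_r (ltW (lt_le_trans ta ab))) !max_l// ltW.
  have [xb|bx] := ltP x b; last first.
    apply: cvg_near_cst; near=> t.
    have xt : x < t by [].
    by rewrite /h /clamp !min_l// (le_trans bx)// ltW.
  rewrite [X in _ --> X](_ : _ = g x); last by rewrite /h clamp_id// ltW.
  apply: cvg_trans (rcg x _); last by rewrite ax.
  apply: near_eq_cvg; near=> t.
  have xt : x < t by [].
  by rewrite /h clamp_id//; [rewrite (le_trans ax)// ltW|near: t; exact: nbhs_right_le].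
exists (HB.pack_for (cumulative R R) h (isCumulative.Build R _ R h ndh rch)).
by move=> t /andP[a_t tb]; rewrite /= /h clamp_id.
Unshelve. all: by end_near. Qed.

Lemma stieltjes_itv u a b : a <= b ->
  lebesgue_stieltjes_measure u `]a, b] = (u b - u a)%:E.
Proof.
move=> ab; rewrite /lebesgue_stieltjes_measure/= /measure_extension/=.
by rewrite measurable_mu_extE/= ?wlength_itv_bnd//; exact: is_ocitv.
Qed.

Lemma stieltjes_integrable u f a b : unif_cont 0 f -> 0 <= a -> a <= b ->
  (lebesgue_stieltjes_measure u).-integrable `]a, b] (EFin \o f).
Proof.
move=> cf a0 ab; have cfab := unif_cont_within (b := b) (unif_contW a0 cf).
apply: measurable_bounded_integrable.
- exact: measurable_itv.
- apply: (@le_lt_trans _ _ (u b - u a)%:E); last exact: ltry.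
  by rewrite -(stieltjes_itv u ab).
- apply: (measurable_funS (E := `[a, b])).
  + exact: measurable_itv.
  + exact: subset_itv_oc_cc.
  + exact: subspace_continuous_measurable_fun.
- have [M Mab HM] := EVT_max ab cfab.
  have [m mab Hm] := EVT_min ab cfab.
  exists (`|f M| + `|f m|); split; first exact: num_real.
  move=> K HK t /= /subset_itv_oc_cc tab; apply: le_trans (ltW HK).
  have := HM t tab; have := Hm t tab; rewrite ler_norml.
  have := ler_norm (f M); have := ler_norm (- f M); rewrite normrN.
  by have := ler_norm (f m); have := ler_norm (- f m); rewrite normrN; lra.
Qed.

Lemma stieltjes_step u f a b e : unif_cont 0 f -> 0 <= a -> a <= b ->
  (forall t, a <= t <= b -> `|f t - f a| <= e) ->
  `|\int[lebesgue_stieltjes_measure u]_(t in `]a, b]) f t - f a * (u b - u a)|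
    <= e * (u b - u a).
Proof.
move=> cf a0 ab He; have intf := stieltjes_integrable u cf a0 ab.
have mab : measurable (`]a, b]%classic : set (measurableTypeR R)).
  exact: measurable_itv.
have intc k : (lebesgue_stieltjes_measure u).-integrable `]a, b] (EFin \o cst k).
  apply: (@stieltjes_integrable u (cst k)) => // T e' e'0.
  by exists 1 => // *; rewrite subrr normr0.
have Ic k : \int[lebesgue_stieltjes_measure u]_(t in `]a, b]) (cst k t) = k * (u b - u a).
  rewrite Rintegral_cst//; congr (_ * _).
  by have /(congr1 fine) := stieltjes_itv u ab.
rewrite ler_norml; apply/andP; split.
  rewrite lerBrDl -mulNr -mulrDl -(Ic (f a - e)).
  apply: le_Rintegral => // t /= tab.
  have := He t ltac:(by move: (subset_itv_oc_cc tab); rewrite /= in_itv).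
  by rewrite ler_norml; lra.
rewrite lerBlDl -mulrDl -(Ic (f a + e)).
apply: le_Rintegral => // t /= tab.
have := He t ltac:(by move: (subset_itv_oc_cc tab); rewrite /= in_itv).
by rewrite ler_norml; lra.
Qed.

Lemma stieltjes_chasles u f a b c : unif_cont 0 f -> 0 <= a -> a <= b -> b <= c ->
  \int[lebesgue_stieltjes_measure u]_(t in `]a, c]) f t =
  \int[lebesgue_stieltjes_measure u]_(t in `]a, b]) f t +
  \int[lebesgue_stieltjes_measure u]_(t in `]b, c]) f t.
Proof.
move=> cf a0 ab bc.
have U : `]a, c]%classic = `]a, b]%classic `|` `]b, c]%classic :> set R.
  by rewrite -itv_bndbnd_setU// bnd_simp.
rewrite U Rintegral_setU//.
- by rewrite -U; apply: stieltjes_integrable => //; exact: le_trans bc.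
- apply/disj_setPS => t [] /=; rewrite !in_itv/= => /andP[_ tb] /andP[bt _].
  by move: bt; rewrite ltNge tb.
Qed.

Lemma stieltjes_riemann u f h N e : unif_cont 0 f -> 0 <= h ->
  (forall i, (i < N)%N -> forall t, i%:R * h <= t <= i.+1%:R * h ->
     `|f t - f (i%:R * h)| <= e) ->
  `|\int[lebesgue_stieltjes_measure u]_(t in `]0, (N%:R * h)]) f t -
    \sum_(0 <= i < N) f (i%:R * h) * (u (i.+1%:R * h) - u (i%:R * h))|
  <= e * (u (N%:R * h) - u 0).
Proof.
move=> cf h0; elim: N => [|N IH] He.
  by rewrite mul0r set_itvoc0 Rintegral_set0 big_geq// !subrr normr0 mulr0.
have N0 : 0 <= N%:R * h by rewrite mulr_ge0.
have NN : N%:R * h <= N.+1%:R * h by rewrite ler_wpM2r// ler_nat.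
rewrite (stieltjes_chasles u cf (lexx 0) N0 NN) big_nat_recr//=.
have := IH (fun i iN => He i (ltnW iN)).
have := stieltjes_step u cf N0 NN (He N (ltnSn N)).
set J := \int[_]_(_ in _) _; set I := \int[_]_(_ in _) _; set S := \sum_(_ <= _ < _) _.
move=> H1 H2.
set D := f _ * _ in H1 *.
have -> : I + J - (S + D) = (I - S) + (J - D) by ring.
apply: le_trans (ler_normD _ _) _.
have -> : e * (u (N.+1%:R * h) - u 0) = e * (u (N%:R * h) - u 0) +
   e * (u (N.+1%:R * h) - u (N%:R * h)) by ring.
exact: lerD.
Qed.

(** The integrator is decomposed into its positive and negative variations, and
    the error of a Riemann sum is bounded by the oscillation of [f] over one step
    times the sum of the two variations. *)
Lemma stieltjes_exists f y : unif_cont 0 f -> unif_cont 0 y ->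
  bounded_variation 0 1 y ->
  exists I, lebesgue_stieltjes_integral f y 0 1 I /\
    forall e, 0 < e -> exists2 d : R, 0 < d & forall N, (0 < N)%N -> N%:R^-1 < d ->
    `|I - \sum_(0 <= i < N)
       f (i%:R / N%:R) * (y (i.+1%:R / N%:R) - y (i%:R / N%:R))| <= e.
Proof.
move=> cf cy bvy.
have le01 : (0 : R) <= 1 by [].
have bvNy := bounded_variationN bvy.
have rc (z : R -> R) : unif_cont 0 z -> bounded_variation 0 1 z -> forall x, 0 <= x < 1 ->
    (fine \o neg_tv 0 z) t @[t --> x^'+] --> (fine \o neg_tv 0 z) x.
  move=> cz bvz x /andP[x0 x1]; apply: (@neg_tv_right_continuous _ 0 x 1) => //.
  exact: unif_cont_right cz x0.
have nd (z : R -> R) : bounded_variation 0 1 z ->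
    {in `[(0 : R), 1] &, {homo (fine \o neg_tv 0 z) : s t / s <= t}}.
  by move=> bvz; exact: fine_neg_tv_nondecreasing.
have [u uE] := cumulative_extension le01 (nd _ bvNy) (rc _ (unif_contN cy) bvNy).
have [v vE] := cumulative_extension le01 (nd _ bvy) (rc _ cy bvy).
have yE t : 0 <= t <= 1 -> y t = u t - v t.
  by move=> t01; rewrite uE// vE// (bounded_variation_pos_neg_tvE bvy).
eexists; split.
  exists u, v; split; last by [].
  - by move=> t; rewrite in_itv; exact: yE.
  - exact: stieltjes_integrable.
  - exact: stieltjes_integrable.
move=> e e0; pose V := (u 1 - u 0) + (v 1 - v 0) + 1.
have u01 : u 0 <= u 1 by rewrite (cumulative_is_nondecreasing u).
have v01 : v 0 <= v 1 by rewrite (cumulative_is_nondecreasing v).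
have V0 : 0 < V by rewrite /V; lra.
have [d d0 Hd] := cf 1 _ (divr_gt0 e0 V0); exists d => // N N0 Nd.
have NN0 : N%:R != 0 :> R by rewrite pnatr_eq0 -lt0n.
have h0 : 0 <= N%:R^-1 :> R by rewrite invr_ge0.
have He i : (i < N)%N -> forall t, i%:R / N%:R <= t <= i.+1%:R / N%:R ->
    `|f t - f (i%:R / N%:R)| <= e / V.
  move=> iN t /andP[it ti]; apply: ltW; apply: Hd => //.
  - by rewrite (le_trans ti)// ler_pdivrMr ?ltr0n// mul1r ler_nat.
  - apply: le_lt_trans Nd; rewrite lerBlDr (le_trans ti)// -[X in X + _]mul1r.
    by rewrite -mulrDl -natr1 addrC.
have := stieltjes_riemann u cf h0 He; have := stieltjes_riemann v cf h0 He.
rewrite divff//; set Iu := \int[_]_(_ in _) _; set Iv := \int[_]_(_ in _) _.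
move: Iu Iv => Iv Iu.
set Sv := \sum_(_ <= _ < _) _ => Hv; set Su := \sum_(_ <= _ < _) _ => Hu.
have -> : \sum_(0 <= i < N) f (i%:R / N%:R) * (y (i.+1%:R / N%:R) - y (i%:R / N%:R))
   = Su - Sv.
  rewrite /Su /Sv -sumrB; apply: eq_big_nat => i /andP[_ iN].
  rewrite !yE; first by ring.
    by rewrite mulr_ge0//= ler_pdivrMr ?ltr0n// mul1r ler_nat ltnW.
  by rewrite mulr_ge0//= ler_pdivrMr ?ltr0n// mul1r ler_nat.
have -> : Iu - Iv - (Su - Sv) = (Iu - Su) - (Iv - Sv) by ring.
apply: le_trans (ler_normB _ _) _; apply: le_trans (lerD Hu Hv) _.
rewrite -mulrDr -mulrA ler_piMr//; first lra.
by rewrite mulrC ler_pdivrMr// mul1r /V; lra.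
Qed.

End stieltjes.

(** * A pathwise lower bound for the integral *)
Section lower_bound.
Context {R : realType}.
Implicit Types (X y z : R -> R) (c k e x : R).

Definition step_variation y (m : nat) : R :=
  \sum_(0 <= j < m) `|y (j.+1%:R / m%:R) - y (j%:R / m%:R)|.

Lemma step_variation_ge0 y m : 0 <= step_variation y m.
Proof. by rewrite sumr_ge0. Qed.

Lemma step_variation_refine y (m M : nat) : (0 < M)%N ->
  step_variation y m <= step_variation y (m * M).
Proof.
move=> M0; rewrite /step_variation big_nat_mul; apply: ler_sum_nat => j /andP[_ jm].
have E i : (i * M)%:R / (m * M)%:R = i%:R / m%:R :> R.
  by rewrite !natrM -mulf_div divff ?mulr1// pnatr_eq0 -lt0n.
rewrite -(E j.+1) -(E j).
apply: le_trans (ler_norm_sum _ _ _).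
rewrite (telescope_sumr (fun i => y (i%:R / (m * M)%:R)))//.
by rewrite leq_mul2r leqnSn orbT.
Qed.

Lemma ratio_itv (i N : nat) : (i < N)%N ->
  [/\ 0 <= i%:R / N%:R :> R, i%:R / N%:R <= i.+1%:R / N%:R :> R,
      i.+1%:R / N%:R <= 1 :> R & i.+1%:R / N%:R - i%:R / N%:R = N%:R^-1 :> R].
Proof.
move=> iN; have N0 : 0 < N%:R :> R by rewrite ltr0n (leq_ltn_trans _ iN).
split; first by rewrite divr_ge0.
- by rewrite ler_pM2r ?invr_gt0// ler_nat.
- by rewrite ler_pdivrMr// mul1r ler_nat.
- by rewrite -mulrBl -natr1 addrAC subrr add0r mul1r.
Qed.

(** Step by step, with [D] the increment of [y],
    [2 * y s * D = (y t ^+ 2 - y s ^+ 2) - D ^+ 2] where [D ^+ 2 <= e * `|D|], and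
    [play_gap] bounds the other term. *)
Lemma play_riemann_ge X c k y z N e : 0 < c -> 0 <= k -> unif_cont 0 X ->
  play c X y -> play (c / 2) X z -> (0 < N)%N -> e <= 2 * c ->
  (forall i, (i < N)%N -> osc_le X (i%:R / N%:R) (i.+1%:R / N%:R) e) ->
  (k * (c / 2) - (k + 1) * e) * step_variation y N - y 0 ^+ 2 <=
  \sum_(0 <= i < N) (2 * y (i%:R / N%:R) + k * (z (i%:R / N%:R) - y (i%:R / N%:R)))
    * (y (i.+1%:R / N%:R) - y (i%:R / N%:R)).
Proof.
move=> c0 k0 cX yP zP N0 ec osc.
have step i : (i < N)%N ->
    (k * (c / 2) - (k + 1) * e) * `|y (i.+1%:R / N%:R) - y (i%:R / N%:R)|
     + (y (i.+1%:R / N%:R) ^+ 2 - y (i%:R / N%:R) ^+ 2)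
    <= (2 * y (i%:R / N%:R) + k * (z (i%:R / N%:R) - y (i%:R / N%:R)))
    * (y (i.+1%:R / N%:R) - y (i%:R / N%:R)).
  move=> iN; have [s0 st t1 _] := ratio_itv iN; have o := osc i iN.
  have zX : `|z (i%:R / N%:R) - X (i%:R / N%:R)| <= c / 2.
    have c20 : 0 < c / 2 by lra.
    by rewrite ler_norml; have := play_close c20 cX zP s0; lra.
  have G := play_gap c0 cX yP s0 st o ec zX.
  have O := play_osc c0 cX yP s0 st o ec.
  move: G O; set a := y (i.+1%:R / N%:R); set b := y (i%:R / N%:R);
  set w := z _ => G O.
  have S : (a - b) ^+ 2 <= e * `|a - b|.
    by rewrite -(real_normK (num_real (a - b))) expr2 ler_wpM2r.
  have := ler_wpM2l k0 G.
  have -> : (2 * b + k * (w - b)) * (a - b) =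
     (a ^+ 2 - b ^+ 2) - (a - b) ^+ 2 + k * ((w - b) * (a - b)) by ring.
  lra.
have tele : \sum_(0 <= i < N) (y (i.+1%:R / N%:R) ^+ 2 - y (i%:R / N%:R) ^+ 2)
    = y 1 ^+ 2 - y 0 ^+ 2.
  rewrite (telescope_sumr (fun i => y (i%:R / N%:R) ^+ 2))// mul0r divff//.
  by rewrite pnatr_eq0 -lt0n.
apply: (@le_trans _ _ ((k * (c / 2) - (k + 1) * e) * step_variation y N
   + (y 1 ^+ 2 - y 0 ^+ 2))).
  by have := sqr_ge0 (y 1); lra.
rewrite -tele /step_variation mulr_sumr -big_split/=.
by apply: ler_sum_nat => i /andP[_ iN]; exact: step.
Qed.

(** Riemann sums on refinements of the grid with [m] steps; the constant [1]
    absorbs the Riemann error and the oscillation terms. *)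
Lemma play_integral_ge X c k y z : 0 < c -> 0 < k -> unif_cont 0 X ->
  play c X y -> play (c / 2) X z ->
  exists I, lebesgue_stieltjes_integral (fun t => 2 * y t + k * (z t - y t)) y 0 1 I /\
    forall m, (0 < m)%N -> k * (c / 2) * step_variation y m - y 0 ^+ 2 - 1 <= I.
Proof.
move=> c0 k0 cX yP zP; have c20 : 0 < c / 2 by lra.
have cy := play_unif c0 cX yP; have cz := play_unif c20 cX zP.
have cZ : unif_cont 0 (fun t => 2 * y t + k * (z t - y t)).
  apply: unif_contD; first exact: unif_contZ.
  by apply: unif_contZ; apply: unif_contD => //; exact: unif_contN.
have bvy : bounded_variation 0 1 y.
  have := @play_bounded_variation _ c X y 1 1 c0 cX yP ler01.
  by congr bounded_variation; apply/funext => t; rewrite mul1r.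
have [I [II HI]] := stieltjes_exists cZ cy bvy; exists I; split=> // m m0.
have [d d0 Hd] := HI (1 / 2) ltac:(lra).
set D := step_variation y m; have D0 : 0 <= D := step_variation_ge0 y m.
(* [e] is small enough for the coefficient of the variation to be nonnegative,
   for the play rule to apply, and for the loss [(k + 1) * e * D] to be at most
   one half. *)
pose e := Num.min (Num.min (k * (c / 2) / (k + 1)) (2 * c))
                  (1 / 2 / ((k + 1) * (D + 1))).
have e0 : 0 < e.
  by rewrite !lt_min; apply/andP; split; [apply/andP; split|];
     rewrite ?divr_gt0 ?mulr_gt0//; lra.
have e1 : (k + 1) * e <= k * (c / 2).
  rewrite mulrC -ler_pdivlMr; last lra.
  by rewrite /e !ge_min lexx.
have e2 : e <= 2 * c by rewrite /e !ge_min lexx orbT.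
have e3 : (k + 1) * e * D <= 1 / 2.
  apply: (@le_trans _ _ (e * ((k + 1) * (D + 1)))).
    rewrite -subr_ge0 (_ : _ - _ = e * (k + 1)); last by ring.
    by rewrite mulr_ge0//; lra.
  rewrite -ler_pdivlMr; last by rewrite mulr_gt0//; lra.
  by rewrite /e ge_min lexx orbT.
have [d' d'0 Hd'] := osc_le_unif 1 cX e0.
pose M := (Num.truncn (Num.max d^-1 d'^-1)).+1.
have M0 : (0 < M)%N by [].
have mM0 : (0 < m * M)%N by rewrite muln_gt0 m0.
have MR : Num.max d^-1 d'^-1 < (m * M)%:R.
  apply: lt_le_trans (truncnS_gt _) _; rewrite ler_nat -/M.
  by rewrite leq_pmull.
have Nd : (m * M)%:R^-1 < d.
  rewrite invf_plt ?posrE ?ltr0n//; apply: le_lt_trans MR.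
  by rewrite le_max lexx.
have Nd' : (m * M)%:R^-1 < d'.
  rewrite invf_plt ?posrE ?ltr0n//; apply: le_lt_trans MR.
  by rewrite le_max lexx orbT.
have osc i : (i < m * M)%N -> osc_le X (i%:R / (m * M)%:R) (i.+1%:R / (m * M)%:R) e.
  by move=> /ratio_itv[s0 st t1 E]; apply: Hd' => //; rewrite E.
have := play_riemann_ge c0 (ltW k0) cX yP zP mM0 e2 osc.
have := Hd _ mM0 Nd; rewrite ler_norml => /andP[+ _].
set S := \sum_(_ <= _ < _) _ => H1 H2.
have ref := step_variation_refine y m M0; rewrite -/D in ref.
have co : 0 <= k * (c / 2) - (k + 1) * e by lra.
have := ler_wpM2l co ref; lra.
Qed.

Definition big_steps x (b : nat -> R) (m : nat) : nat :=
  \sum_(0 <= j < m) (x < `|b j.+1 - b j|)%R.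

(** When [X] moves by more than [x], a path within [c] of [X] moves by at least
    [x - 2 * c]. *)
Lemma step_variation_play_ge X c y x m : 0 < c -> unif_cont 0 X -> play c X y ->
  (x - 2 * c) * (big_steps x (fun j => X (j%:R / m%:R)) m)%:R <= step_variation y m.
Proof.
move=> c0 cX yP; rewrite /big_steps natr_sum mulr_sumr; apply: ler_sum_nat => j /andP[_ jm].
have [s0 st _ _] := ratio_itv jm; have t0 := le_trans s0 st.
case: ltP => [xX|_]; last by rewrite mulr0.
rewrite mulr1; have := play_close c0 cX yP s0; have := play_close c0 cX yP t0.
move: xX; set a := X (j.+1%:R / _); set b := X _; set a' := y (j.+1%:R / _).
set b' := y _ => xX Ha Hb.
have := ler_norm (a' - b'); have := ler_norm (b' - a'); rewrite (distrC b' a').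
have [ab|ab] := leP 0 (a - b); [rewrite ger0_norm// in xX|rewrite ltr0_norm// in xX]; lra.
Qed.

End lower_bound.

(** * Adaptedness *)
Section filtration.
Context {R : realType} {d : measure_display} {T : measurableType d}.
Variable B : R -> T -> R.
Implicit Types (s t : R).

Definition past_events t : set (set T) := [set E | exists2 s, 0 <= s <= t &
  exists2 A : set R, measurable A & E = B s @^-1` A].

Definition pastType t := g_sigma_algebraType (past_events t).

Lemma measurable_past s t : 0 <= s <= t ->
  measurable_fun [set: pastType t] (B s : pastType t -> R).
Proof.
move=> st _ A mA; rewrite setTI; apply: sub_sigma_algebra.
by exists s => //; exists A.
Qed.

Lemma natural_filtrationP t (f : pastType t -> R) (A : set R) :
  measurable_fun setT f -> measurable A -> natural_filtration B t (f @^-1` A).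
Proof. by move=> mf mA; have := mf measurableT _ mA; rewrite setTI. Qed.

Lemma natural_filtrationS s t : s <= t ->
  natural_filtration B s `<=` natural_filtration B t.
Proof.
move=> st; apply: sub_sigma_algebra2 => E [r /andP[r0 rs] [A mA ->]].
by exists r; [rewrite r0 (le_trans rs)|exists A].
Qed.

Lemma natural_filtrationC t E :
  natural_filtration B t E -> natural_filtration B t (~` E).
Proof. exact: sigma_algebraC. Qed.

Lemma natural_filtrationU t E F : natural_filtration B t E ->
  natural_filtration B t F -> natural_filtration B t (E `|` F).
Proof.
by move=> mE mF; exact: (@measurableU _ (pastType t) E F).
Qed.

Lemma natural_filtrationI t E F : natural_filtration B t E ->
  natural_filtration B t F -> natural_filtration B t (E `&` F).
Proof.
by move=> mE mF; exact: (@measurableI _ (pastType t) E F).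
Qed.

Lemma natural_filtration_measurable t E :
  (forall s, 0 <= s -> measurable_fun setT (B s)) ->
  natural_filtration B t E -> measurable E.
Proof.
move=> mB; apply: smallest_sub; first exact: sigma_algebra_measurable.
move=> _ [s /andP[s0 _] [A mA ->]].
by rewrite -[X in measurable X]setTI; exact: mB.
Qed.

Lemma adapted_augmentation (P : probability T R) (W : R -> T -> R) :
  (forall t, 0 <= t -> measurable_fun setT (W t : pastType t -> R)) ->
  adapted (augmentation P (natural_filtration B)) W.
Proof.
move=> mW t t0 A mA s /= ts; apply: sub_sigma_algebra; left.
apply: (natural_filtrationS (ltW ts)).
by apply: (@natural_filtrationP t (W t)) => //; exact: mW.
Qed.

(** [reg c X t] is the limit of the discrete play rule along equidistant grids of
    [0, t], each of which involves finitely many values of the path before [t]. *)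
Lemma reg_process_past c t : 0 < c -> 0 <= t ->
  (forall w, {within `[0, +oo[, continuous (B ^~ w)}) ->
  measurable_fun setT (reg_process c B t : pastType t -> R).
Proof.
move=> c0 t0 cB.
apply: (@measurable_fun_cvg _ _ _ _ (fun N (w : pastType t) =>
  discrete_play c (fun i => B (i%:R * (t / N.+1%:R)) w) N.+1)); last first.
  move=> w _; have cX := unif_cont_path (cB w).
  have [yP y0] := play_reg c0 cX.
  exact: (discrete_play_cvg c0 cX yP y0 t0).
move=> N; set h := t / N.+1%:R.
have hN i : (i <= N.+1)%N -> 0 <= i%:R * h <= t.
  move=> iN; rewrite mulr_ge0 ?divr_ge0//= mulrCA ler_piMr//.
  by rewrite ler_pdivrMr ?ltr0n// mul1r ler_nat.
elim: {1 3}N.+1 (leqnn N.+1) => [_|i IH iN]; first exact: measurable_past (hN 0%N isT).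
have mBi := measurable_past (hN _ iN).
apply: measurable_maxr; first by apply: measurable_funB => //; exact: mBi.
apply: measurable_minr; first by apply: measurable_funD => //; exact: mBi.
by apply: IH; exact: ltnW.
Qed.

End filtration.

(** * Brownian paths make many big steps *)
Section brownian.
Context {R : realType} {d : measure_display} {T : measurableType d}.
Variables (P : probability T R) (B : R -> T -> R).
Implicit Types (s t x h : R).

(** The normal density is at most [1 / (sigma * sqrt (2 * pi))], which is at most
    [1 / (2 * sigma)]. *)
Lemma normal_prob_itv_le (sigma x : R) : 0 < sigma -> 0 <= x -> x <= sigma / 2 ->
  (normal_prob 0 sigma `[(- x)%R, x]%classic <= (2^-1)%:E)%E.
Proof.
move=> s0 x0 xs; have sn0 : sigma != 0 by rewrite gt_eqF.
have mI : measurable (`[(- x)%R, x]%classic : set R) by exact: measurable_itv.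
apply: (@le_trans _ _ (\int[lebesgue_measure]_(y in `[(- x)%R, x]) (normal_peak sigma)%:E)%E).
  apply: ge0_le_integral => //=.
  - by move=> y _; rewrite lee_fin normal_pdf_ge0.
  - by apply/measurable_funTS/measurable_EFinP; exact: measurable_normal_pdf.
  - by move=> y _; rewrite lee_fin normal_pdf_ub.
rewrite integral_cst//= lebesgue_measure_itv/= lte_fin.
case: ifPn => _; last by rewrite mule0 lee_fin.
rewrite -EFinD -EFinM lee_fin opprK.
have peak : normal_peak sigma <= (2 * sigma)^-1.
  rewrite /normal_peak lef_pV2 ?posrE ?mulr_gt0 ?sqrtr_gt0//; last first.
    by rewrite pmulrn_lgt0// mulr_gt0 ?exprn_gt0 ?pi_gt0.
  rewrite -[leLHS]gtr0_norm ?mulr_gt0// -sqrtr_sqr ler_wsqrtr//.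
  rewrite -subr_ge0 (_ : _ - _ = 2 * (sigma ^+ 2 * (pi - 2))); last by ring.
  by apply: mulr_ge0 => //; apply: mulr_ge0; rewrite ?sqr_ge0 ?subr_ge0 ?pi_ge2.
apply: (@le_trans _ _ ((2 * sigma)^-1 * (x + x))).
  by rewrite ler_wpM2r// addr_ge0.
rewrite mulrC ler_pdivrMr ?mulr_gt0//; lra.
Qed.

Hypothesis BM : standard_brownian_motion P B.

Let mB s : 0 <= s -> measurable_fun setT (B s).
Proof. by case: BM => H _ _ _ _; exact: H. Qed.

Definition small_increment x s t : set T :=
  (fun w => B t w - B s w) @^-1` `[(- x)%R, x]%classic.

Lemma small_increment_past x s t : 0 <= s -> s <= t ->
  natural_filtration B t (small_increment x s t).
Proof.
move=> s0 st; apply: (@natural_filtrationP _ _ _ B t (fun w => B t w - B s w)).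
  apply: measurable_funB; apply: measurable_past.
    by rewrite (le_trans s0 st) lexx.
  by rewrite s0 st.
exact: measurable_itv.
Qed.

Definition few_big_steps x h (k j : nat) : set T :=
  [set w | (big_steps x (fun i => B (i%:R * h) w) k <= j)%N].

Lemma small_incrementE x s t w :
  small_increment x s t w <-> (x < `|B t w - B s w|) = false.
Proof.
rewrite /small_increment /= in_itv/= -ler_norml leNgt.
by split=> [/negbTE|->].
Qed.

Lemma few_big_stepsS0 x h k : few_big_steps x h k.+1 0 =
  few_big_steps x h k 0 `&` small_increment x (k%:R * h) (k.+1%:R * h).
Proof.
apply/seteqP; split=> w; rewrite /few_big_steps /= /big_steps big_nat_recr//= !leqn0 addn_eq0.
  by move=> /andP[-> H]; split=> //; apply/small_incrementE; case: (_ < _) H.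
by move=> [-> /small_incrementE ->].
Qed.

Lemma few_big_stepsSS x h k j : few_big_steps x h k.+1 j.+1 =
  (few_big_steps x h k j `&` ~` small_increment x (k%:R * h) (k.+1%:R * h)) `|`
  (few_big_steps x h k j.+1 `&` small_increment x (k%:R * h) (k.+1%:R * h)).
Proof.
apply/seteqP; split=> w; rewrite /few_big_steps /= /big_steps big_nat_recr//=.
  case E : (x < _) => /= H; [left|right]; split=> //.
  - by move: H; rewrite addn1.
  - by move=> /small_incrementE; rewrite E.
  - by move: H; rewrite addn0.
  - by apply/small_incrementE.
move=> [[H1 H2]|[H1 /small_incrementE ->]]; last by rewrite addn0.
case E : (x < _) => /=; first by rewrite addn1.
by exfalso; apply: H2; apply/small_incrementE.
Qed.

Lemma few_big_steps_past x h k j : 0 <= h ->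
  natural_filtration B (k%:R * h) (few_big_steps x h k j).
Proof.
move=> h0; elim: k j => [|k IH] j.
  rewrite (_ : few_big_steps _ _ _ _ = setT); first exact: (@measurableT _ (pastType B _)).
  by apply/seteqP; split=> w //= _; rewrite /few_big_steps /big_steps/= big_geq.
have k0 : 0 <= k%:R * h by rewrite mulr_ge0.
have kk : k%:R * h <= k.+1%:R * h by rewrite ler_wpM2r// ler_nat.
have D := small_increment_past x k0 kk.
case: j => [|j].
  rewrite few_big_stepsS0; apply: natural_filtrationI => //.
  exact: natural_filtrationS kk _ (IH _).
rewrite few_big_stepsSS; apply: natural_filtrationU.
  apply: natural_filtrationI; last exact: natural_filtrationC.
  exact: natural_filtrationS kk _ (IH _).
apply: natural_filtrationI => //.
exact: natural_filtrationS kk _ (IH _).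
Qed.

Lemma few_big_steps_measurable x h k j : 0 <= h -> measurable (few_big_steps x h k j).
Proof.
by move=> h0; apply: (natural_filtration_measurable mB); exact: few_big_steps_past.
Qed.

(** Induction on [k]. At most [j + 1] of the first [k + 1] steps are big if at most
    [j] of the first [k] are and the last one is big, or if at most [j + 1] of the
    first [k] are and the last one is small. With [b <= 1 / 2] the probability of a
    small step, the bound at [k] gives
    [2 ^ j * (3 / 4) ^ k * ((1 - b) + 2 * b)], and [1 + b <= 2 * (3 / 4)]. *)
Lemma few_big_steps_le x h k j : 0 < h -> 0 <= x -> x <= Num.sqrt h / 2 ->
  (P (few_big_steps x h k j) <= (2 ^+ j * (3 / 4) ^+ k)%:E)%E.
Proof.
move=> h0 x0 xh; elim: k j => [|k IH] j.
  rewrite (le_trans (probability_le1 P _))//.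
    exact: few_big_steps_measurable (ltW h0).
  by rewrite expr0 mulr1 lee_fin exprn_ege1// ler1n.
have k0 : 0 <= k%:R * h by rewrite mulr_ge0// ltW.
have kk : k%:R * h < k.+1%:R * h by rewrite ltr_pM2r// ltr_nat.
have khh : k.+1%:R * h - k%:R * h = h by rewrite -mulrBl -natr1 addrAC subrr add0r mul1r.
set D := small_increment x (k%:R * h) (k.+1%:R * h).
have mD : measurable D.
  apply: (natural_filtration_measurable mB).
  exact: small_increment_past k0 (ltW kk).
have [_ _ _ law indep] := BM.
have PD : (P D <= (2^-1)%:E)%E.
  rewrite /D /small_increment law; [|by rewrite k0|exact: measurable_itv].
  by rewrite khh; apply: normal_prob_itv_le => //; rewrite sqrtr_gt0.
have ind E : natural_filtration B (k%:R * h) E -> P (E `&` D) = (P E * P D)%E.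
  by move=> FE; apply: indep; rewrite ?k0//; exact: measurable_itv.
have indC E : natural_filtration B (k%:R * h) E -> P (E `&` ~` D) = (P E * P (~` D))%E.
  move=> FE; rewrite {1}/D /small_increment preimage_setC.
  by apply: indep; rewrite ?k0//; apply: measurableC; exact: measurable_itv.
have [b Eb] : exists b, P D = b%:E.
  by exists (fine (P D)); rewrite fineK// fin_num_measure.
rewrite Eb lee_fin in PD.
have b0 : 0 <= b by rewrite -lee_fin -Eb.
have EbC : P (~` D) = (1 - b)%:E by rewrite probability_setC// Eb.
have past i : natural_filtration B (k%:R * h) (few_big_steps x h k i).
  exact: few_big_steps_past (ltW h0).
have r0 : 0 <= (3 / 4) ^+ k :> R by rewrite exprn_ge0.
case: j => [|j].
  rewrite few_big_stepsS0 ind// Eb.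
  apply: (@le_trans _ _ ((2 ^+ 0 * (3 / 4) ^+ k)%:E * b%:E)%E).
    by rewrite lee_wpmul2r// lee_fin.
  rewrite -EFinM lee_fin !expr0 !mul1r exprSr ler_wpM2l//; lra.
rewrite few_big_stepsSS.
apply: (@le_trans _ _ (P (few_big_steps x h k j) * P (~` D) +
    P (few_big_steps x h k j.+1) * P D)%E).
  rewrite -indC// -ind//; apply: measureU2; apply: measurableI => //;
    try exact: measurableC; exact: few_big_steps_measurable (ltW h0).
rewrite Eb EbC.
apply: (@le_trans _ _ ((2 ^+ j * (3 / 4) ^+ k)%:E * (1 - b)%:E +
   (2 ^+ j.+1 * (3 / 4) ^+ k)%:E * b%:E)%E).
  by apply: leeD; apply: lee_wpmul2r => //; rewrite lee_fin; lra.
rewrite -!EFinM -EFinD lee_fin !exprS.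
have a0 : 0 <= 2 ^+ j * (3 / 4) ^+ k :> R by rewrite mulr_ge0// exprn_ge0.
have := ler_wpM2l a0 PD; lra.
Qed.

(** With [4 * n ^ 3] steps, the probability of at most [n ^ 3] big ones is at most
    [(2 * (3 / 4) ^ 4) ^ (n ^ 3)], and Borel-Cantelli applies. *)
Lemma ae_many_big_steps (h x : nat -> R) :
  (forall n, (0 < n)%N -> 0 < h n /\ 0 <= x n <= Num.sqrt (h n) / 2) ->
  {ae P, forall w, \forall n \near \oo,
    (n ^ 3 < big_steps (x n) (fun i => B (i%:R * h n)%R w) (4 * n ^ 3))%N}.
Proof.
move=> H; pose F n := few_big_steps (x n.+1) (h n.+1) (4 * n.+1 ^ 3) (n.+1 ^ 3).
have hn n : 0 < h n.+1 /\ 0 <= x n.+1 <= Num.sqrt (h n.+1) / 2 by exact: H.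
have mF n : measurable (F n).
  by apply: few_big_steps_measurable; have [/ltW] := hn n.
pose q : R := 81 / 128.
have PF n : (P (F n) <= (geometric 1 q n)%:E)%E.
  have [h0 /andP[x0 xh]] := hn n.
  apply: le_trans (few_big_steps_le _ _ h0 x0 xh) _; rewrite lee_fin /geometric/= mul1r.
  rewrite exprM -exprMn (_ : 2 * _ = q); last by rewrite /q; lra.
  rewrite ler_wiXn2l ?/q; [|lra|lra|].
    by [].
  by rewrite (leq_trans (leqnSn n))// -{1}(expn1 n.+1) leq_pexp2l.
have PlimF : P (lim_sup_set F) = 0%E.
  apply: lim_sup_set_cvg0 => //.
  apply: (@le_lt_trans _ _ (1 * (1 - q)^-1)%:E); last exact: ltry.
  apply: lime_le; first by apply: is_cvg_nneseries => *; exact: measure_ge0.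
  apply: nearW => n; apply: (@le_trans _ _ (series (geometric 1 q) n)%:E).
    by rewrite /series/= -sumEFin; apply: lee_sum => i _; exact: PF.
  rewrite lee_fin; apply: geometric_le_lim => //; rewrite /q; first lra.
  by rewrite ger0_norm; lra.
exists (lim_sup_set F); split=> //.
  by apply: bigcap_measurable => // k _; apply: bigcup_measurable => i _; exact: mF.
move=> w /= Hw n _; apply: contrapT => Hn; apply: Hw; exists n.+1 => //= -[//|i] ni.
rewrite ltnNge; apply/negP => Hi; apply: Hn; exists i => //=.
Qed.

End brownian.

(** * The approximating processes *)
Section approximations.
Context {R : realType} {d : measure_display} {T : measurableType d}.
Variables (P : probability T R) (B : R -> T -> R).
Hypothesis cB : forall w, {within `[0, +oo[, continuous (B ^~ w)}.

Lemma locally_finite_variationD (f g : R -> R) :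
  locally_finite_variation f -> locally_finite_variation g ->
  locally_finite_variation (f \+ g).
Proof.
move=> Hf Hg t; rewrite le_eqVlt => /predU1P[<-|t0].
  exact: bounded_variationxx.
by apply: bounded_variationD => //; [apply: Hf|apply: Hg]; exact: ltW.
Qed.

Lemma reg_locally_finite_variation (c k : R) (X : R -> R) :
  0 < c -> unif_cont 0 X ->
  locally_finite_variation (fun t => k * reg c X t).
Proof.
move=> c0 cX t t0; have [yP _] := play_reg c0 cX.
exact: play_bounded_variation c0 cX yP t0.
Qed.

Lemma unif_cont_reg (c : R) (X : R -> R) :
  0 < c -> unif_cont 0 X -> unif_cont 0 (reg c X).
Proof. by move=> c0 cX; have [yP _] := play_reg c0 cX; exact: play_unif cX yP. Qed.

Lemma reg_close (c t : R) (X : R -> R) :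
  0 < c -> unif_cont 0 X -> 0 <= t -> `|X t - reg c X t| <= c.
Proof.
move=> c0 cX t0; have [yP _] := play_reg c0 cX; have := play_close c0 cX yP t0.
by rewrite ler_norml; lra.
Qed.

Definition level (n : nat) : R := (n%:R ^+ 2)^-1.

Lemma half_level n : (2 * n%:R ^+ 2)^-1 = level n / 2 :> R.
Proof. by rewrite invfM mulrC. Qed.

Lemma level_gt0 n : (0 < n)%N -> 0 < level n.
Proof. by move=> n0; rewrite invr_gt0 exprn_gt0// ltr0n. Qed.

Lemma level_le_delta n : (0 < n)%N -> n%:R * level n = delta n /\ level n <= delta n.
Proof.
move=> n0; have nn0 : n%:R != 0 :> R by rewrite pnatr_eq0 -lt0n.
have E : n%:R * level n = delta n by rewrite /level expr2 invfM mulrA divff// mul1r.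
split=> //; rewrite -E ler_peMl ?ler1n//; exact/ltW/level_gt0.
Qed.

Lemma Btilde_fv_approximation :
  fv_approximation (augmentation P (natural_filtration B)) (fun=> 4) (fun=> 0) delta
    B (Btilde_approx B).
Proof.
move=> n n0; have c0 := level_gt0 n0; have cX w := unif_cont_path (@cB w).
split.
- move=> w t t0; have := reg_locally_finite_variation 1 c0 (cX w) t0.
  by congr bounded_variation; apply/funext => s; rewrite mul1r.
- by move=> w; apply: unif_cont_cadlag; exact: unif_cont_reg.
- move=> w S t /andP[t0 _]; apply: le_trans (reg_close c0 (cX w) t0) _.
  by have [_] := level_le_delta n0; lra.
- move=> w S t _; rewrite unif_cont_jump ?normr0 ?mul0r//.
  exact: unif_cont_reg c0 (cX w).
- by apply: adapted_augmentation => t t0; exact: reg_process_past.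
Qed.

Lemma Z_fv_approximation :
  fv_approximation (augmentation P (natural_filtration B)) (fun=> 4) (fun=> 0) delta
    (fun t w => 2 * B t w) (Z_approx B).
Proof.
move=> n n0; have c0 := level_gt0 n0; have cX w := unif_cont_path (@cB w).
have c20 : 0 < level n / 2 by rewrite divr_gt0.
have ZE w t : Z_approx B n t w = 2 * reg (level n) (B ^~ w) t +
    n%:R * (reg (level n / 2) (B ^~ w) t - reg (level n) (B ^~ w) t).
  by rewrite /Z_approx /reg_process half_level.
have cZ w : unif_cont 0 (Z_approx B n ^~ w).
  rewrite (_ : _ ^~ _ = fun t => 2 * reg (level n) (B ^~ w) t +
    n%:R * (reg (level n / 2) (B ^~ w) t + (\- reg (level n) (B ^~ w)) t)); last first.
    by apply/funext => t; rewrite ZE.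
  have cy := unif_cont_reg c0 (cX w).
  apply: unif_contD; first exact: unif_contZ.
  apply: unif_contZ; apply: unif_contD; first exact: unif_cont_reg.
  exact: unif_contN.
split.
- move=> w; have L1 := reg_locally_finite_variation (2 - n%:R) c0 (cX w).
  have L2 := reg_locally_finite_variation n%:R c20 (cX w).
  have := locally_finite_variationD L1 L2.
  congr locally_finite_variation; apply/funext => t; rewrite ZE /=; ring.
- by move=> w; exact: unif_cont_cadlag.
- move=> w S t /andP[t0 _]; rewrite ZE.
  have := reg_close c0 (cX w) t0; have := reg_close c20 (cX w) t0.
  move: (B t w) (reg _ _ t) (reg _ _ t) => b z y.
  have [E le] := level_le_delta n0.
  rewrite !ler_norml => /andP[z1 z2] /andP[y1 y2].
  have z1' := ler_wpM2l (ler0n R n) z1; have z2' := ler_wpM2l (ler0n R n) z2.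
  have y1' := ler_wpM2l (ler0n R n) y1; have y2' := ler_wpM2l (ler0n R n) y2.
  by apply/andP; split; lra.
- by move=> w S t _; rewrite unif_cont_jump ?normr0 ?mul0r.
- apply: adapted_augmentation => t t0.
  have m1 := reg_process_past c0 t0 (@cB); have m2 := reg_process_past c20 t0 (@cB).
  rewrite (_ : Z_approx B n t = (fun w => 2 * reg_process (level n) B t w +
     n%:R * (reg_process (level n / 2) B t w - reg_process (level n) B t w))); last first.
    by apply/funext => w; rewrite ZE.
  apply: measurable_funD; first by apply: measurable_funM.
  by apply: measurable_funM => //; exact: measurable_funB.
Qed.

Definition step_size (n : nat) : R := (4 * n ^ 3)%N%:R^-1.
Definition threshold (n : nat) : R := Num.sqrt (step_size n) / 2.

Lemma step_size_gt0 n : (0 < n)%N -> 0 < step_size n.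
Proof. by move=> n0; rewrite invr_gt0 ltr0n muln_gt0 expn_gt0 n0. Qed.

Lemma threshold_ge a n : (0 < n)%N -> 0 <= a -> 16 * a ^+ 2 <= n%:R ->
  a * level n <= threshold n.
Proof.
move=> n0 a0 an; rewrite /threshold ler_pdivlMr//.
have nR : 0 < n%:R :> R by rewrite ltr0n.
have c0 := level_gt0 n0.
rewrite -[leLHS]ger0_norm ?mulr_ge0//; last exact: ltW.
rewrite -sqrtr_sqr ler_wsqrtr//.
have -> : step_size n = n%:R * (4^-1 * level n ^+ 2).
  rewrite /step_size /level natrM natrX.
  by field; rewrite gt_eqF.
rewrite (_ : (a * level n * 2) ^+ 2 = 16 * a ^+ 2 * (4^-1 * level n ^+ 2)); last by field.
by rewrite ler_wpM2r// mulr_ge0// exprn_ge0// ltW.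
Qed.

(** With [m = 4 * n ^ 3] and [x = threshold n], the lower bound is
    [(x - 2 / n ^ 2) * n ^ 3 / (2 * n)] up to a constant, and [x * n ^ 2] is
    eventually larger than any [a] since its square is [n / 16]. *)
Lemma integral_diverges w :
  (\forall n \near \oo, (n ^ 3 < big_steps (threshold n)
     (fun i => B (i%:R * step_size n)%R w) (4 * n ^ 3))%N) ->
  exists2 I : nat -> R,
     (forall n, (0 < n)%N ->
        lebesgue_stieltjes_integral (Z_approx B n ^~ w) (Btilde_approx B n ^~ w)
          0 1 (I n)) &
     I n @[n --> \oo] --> +oo.
Proof.
move=> Hw; pose X := B ^~ w; have cX : unif_cont 0 X := unif_cont_path (@cB w).
have /choice[I HI] : forall n, exists I : R, (0 < n)%N ->
    lebesgue_stieltjes_integral (Z_approx B n ^~ w) (Btilde_approx B n ^~ w) 0 1 I /\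
    forall m, (0 < m)%N ->
     n%:R * (level n / 2) * step_variation (reg (level n) X) m - X 0 ^+ 2 - 1 <= I.
  move=> n; have [->|n0] := posnP n; first by exists 0.
  have c0 := level_gt0 n0; have c20 : 0 < level n / 2 by rewrite divr_gt0.
  have [yP y0] := play_reg c0 cX; have [zP _] := play_reg c20 cX.
  have nR : 0 < n%:R :> R by rewrite ltr0n.
  have [I [II HI]] := play_integral_ge c0 nR cX yP zP.
  exists I => _; split; last by rewrite -y0.
  move: II; congr lebesgue_stieltjes_integral.
  by apply/funext => t; rewrite /Z_approx /reg_process half_level.
exists I; first by move=> n /HI[].
apply/cvgryPge => A.
pose a : R := 2 * (`|A| + X 0 ^+ 2 + 2).
have a4 : 4 <= a by rewrite /a; have := normr_ge0 A; have := sqr_ge0 (X 0); lra.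
near=> n.
have n0 : (0 < n)%N by near: n; exact: nbhs_infty_gt.
have nR : 0 < n%:R :> R by rewrite ltr0n.
have [_ /(_ (4 * n ^ 3)%N)] := HI n n0.
rewrite muln_gt0 expn_gt0 n0 => /(_ isT); apply: le_trans.
have c0 := level_gt0 n0; have [yP y0] := play_reg c0 cX.
have big : (n ^ 3 < big_steps (threshold n)
     (fun i => X (i%:R / (4 * n ^ 3)%N%:R)%R) (4 * n ^ 3))%N by near: n.
have thr : a * level n <= threshold n.
  apply: threshold_ge => //; first lra.
  by near: n; exact: nbhs_infty_ger.
have /(_ (threshold n) (4 * n ^ 3)%N) var := fun x m => step_variation_play_ge x m c0 cX yP.
have {}var : (a - 2) * level n * (n%:R ^+ 3) <= step_variation (reg (level n) X) (4 * n ^ 3).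
  apply: le_trans var; apply: ler_pM.
  - by rewrite mulr_ge0// ?ltW//; lra.
  - by rewrite exprn_ge0.
  - lra.
  - by rewrite -natrX ler_nat ltnW.
have k0 : 0 <= n%:R * (level n / 2) by rewrite mulr_ge0// divr_ge0// ltW.
have := ler_wpM2l k0 var.
have -> : n%:R * (level n / 2) * ((a - 2) * level n * n%:R ^+ 3) = (a - 2) / 2.
  by rewrite /level; field; rewrite gt_eqF.
have := ler_norm A; rewrite /a; lra.
Unshelve. all: by end_near. Qed.

End approximations.

Theorem mainTheorem6 (R : realType) (d : measure_display) (T : measurableType d)
    (P : probability T R) (B : R -> T -> R) :
  standard_brownian_motion P B ->
  (exists K L : R -> R,
     fv_approximation (augmentation P (natural_filtration B)) K L delta
       (fun t w => 2 * B t w) (Z_approx B) /\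
     fv_approximation (augmentation P (natural_filtration B)) K L delta
       B (Btilde_approx B)) /\
  {ae P, forall w, exists2 I : nat -> R,
     (forall n, (0 < n)%N ->
        lebesgue_stieltjes_integral (Z_approx B n ^~ w) (Btilde_approx B n ^~ w)
          0 1 (I n)) &
     I n @[n --> \oo] --> +oo}.
Proof.
move=> BM; have [_ _ cB _ _] := BM; split.
  exists (fun=> 4), (fun=> 0).
  by split; [exact: Z_fv_approximation|exact: Btilde_fv_approximation].
have H n : (0 < n)%N -> 0 < @step_size R n /\
    0 <= @threshold R n <= Num.sqrt (step_size n) / 2.
  by move=> /step_size_gt0 h0; rewrite lexx divr_ge0// sqrtr_ge0.
by apply: filterS (ae_many_big_steps BM H) => w; exact: integral_diverges.
Qed.
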